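(* For all $j,k\in S$ with $j\neq k$, $$E(T_{j,k})=\frac{1-\widehat\gamma_{j,k}(\xi)}{\xi\,\widehat\gamma_{r,k}(\xi)},$$ $$\mathrm{Var}(T_{j,k})=\frac{1}{\xi^2\,\widehat\gamma_{r,k}^2(\xi)}\left\{1-\widehat\gamma_{j,k}^2(\xi)+2\xi\,\big[1-\widehat\gamma_{j,k}(\xi)\big]\frac{d}{d\xi}\widehat\gamma_{r,k}(\xi)+2\xi\,\widehat\gamma_{r,k}(\xi)\frac{d}{d\xi}\widehat\gamma_{j,k}(\xi)\right\},$$ where $\frac{d}{d\xi}\widehat\gamma_{i,k}(\xi)$ is the derivative of the function $\lambda\mapsto\widehat\gamma_{i,k}(\lambda)$ evaluated at $\lambda=\xi$.
   Context: Let $r$ be a nonnegative integer, $S=\{r,r+1,r+2,\ldots\}$, and let $\alpha_n>0$ ($n\ge r$), $\beta_n\ge 0$ ($n\ge r+1$), $\xi>0$ be constants. $\{N(t);t\ge 0\}$ is the continuous-time Markov chain on $S$ (birth-death process with catastrophes) with transitions: $n\to n+1$ with rate $\alpha_n$ for $n\ge r$; $n\to n-1$ with rate $\beta_n$ for $n\ge r+2$; $r+1\to r$ with rate $\beta_{r+1}+\xi$; $n\to r$ with rate $\xi$ for $n\ge r+2$. $\{\widehat N(t);t\ge 0\}$ is the birth-death process on $S$ with the same birth rates $\alpha_n$ and death rates $\beta_n$ but without catastrophes (i.e. its only transitions are $n\to n+1$ with rate $\alpha_n$ for $n\ge r$ and $n\to n-1$ with rate $\beta_n$ for $n\ge r+1$),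 assumed non-explosive: $\sum_{n\ge r}\Pr\{\widehat N(t)=n\mid \widehat N(0)=j\}=1$ for all $j\in S$, $t\ge0$. For $j,k\in S$, $j\ne k$, $T_{j,k}=\inf\{t\ge 0: N(t)=k\}$ given $N(0)=j$. For $\widehat N(t)$, $\widehat T_{j,k}=\inf\{t\ge0:\widehat N(t)=k\}$ given $\widehat N(0)=j$, $\widehat g_{j,k}(t)=\frac{d}{dt}\Pr\{\widehat T_{j,k}\le t\}$ is its (possibly defective) density, and $\widehat\gamma_{j,k}(\lambda)=\int_0^\infty e^{-\lambda t}\widehat g_{j,k}(t)\,dt$, $\lambda>0$. Convention: $\widehat\gamma_{k,k}(\lambda)=1$ for all $k\in S$ and $\lambda>0$. The function $\widehat\gamma_{j,k}$ does not depend on $\xi$. *)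

(* Defs.v *)
From HB Require Import structures.
From mathcomp Require Import all_boot all_order all_algebra.
From mathcomp Require Import all_classical all_reals all_analysis.

Set Implicit Arguments.
Unset Strict Implicit.
Unset Printing Implicit Defensive.
Import Order.TTheory GRing.Theory Num.Theory.
Import numFieldNormedType.Exports.
Local Open Scope classical_set_scope.
Local Open Scope ring_scope.

(* Continuous-time Markov chains on a set [E] of natural numbers, given by the *)
(* rates [q i m] of the transitions i -> m, i <> m.                           *)

Definition exit_rate (R : realType) (q : nat -> nat -> R) (i : nat) : R :=
  fine (\sum_(0 <= m <oo | m != i) (q i m)%:E)%E.

Definition jump_time (R : realType) (Omega : Type) (H : nat -> Omega -> R)
    (n : nat) (w : Omega) : R :=
  \sum_(m < n) H m w.

(* The right-continuous path that stays at [Y n w] during the n-th holding     *)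
(* time [H n w]; it is sent to [None] from the explosion time sup_n J_n on.    *)
Definition is_jump_path (R : realType) (Omega : Type)
    (Y : nat -> Omega -> nat) (H : nat -> Omega -> R)
    (X : R -> Omega -> option nat) : Prop :=
  (forall n t w, jump_time H n w <= t < jump_time H n.+1 w ->
     X t w = Some (Y n w)) /\
  (forall t w, (forall n, jump_time H n w <= t) -> X t w = None).

(* Under [P j] the chain starts at j, its jump chain [Y] is a discrete-time    *)
(* Markov chain with transition probabilities q i m / exit_rate q i (i <> m)   *)
(* and, given [Y], the holding times are independent and exponential with      *)
(* parameters exit_rate q (Y 0), exit_rate q (Y 1), and so on.                *)
(* This is the law of the jump chain and holding times only when every state   *)
(* has a positive exit rate (no absorbing state).                              *)
Definition has_jump_law (R : realType) (d : measure_display)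
    (Omega : measurableType d) (E : set nat) (q : nat -> nat -> R)
    (P : nat -> probability Omega R)
    (Y : nat -> Omega -> nat) (H : nat -> Omega -> R) : Prop :=
  forall (j n : nat) (i : nat -> nat) (s : nat -> R),
    E j -> (forall m, (m <= n)%N -> E (i m)) ->
    (forall m, (m < n)%N -> 0 <= s m) ->
    P j [set w | (forall m, (m <= n)%N -> Y m w = i m) /\
                 (forall m, (m < n)%N -> s m < H m w)] =
    ((i 0%N == j)%:R *
     \prod_(m < n)
       ((if i m.+1 == i m then 0 else q (i m) (i m.+1) / exit_rate q (i m)) *
        expR (- (exit_rate q (i m) * s m))))%:E.

(* [X] is, under the family [P j] (j in E) of laws given X 0 = j, the minimal  *)
(* continuous-time Markov chain on [E] with transition rates [q].              *)
Definition is_markov_chain (R : realType) (d : measure_display)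
    (Omega : measurableType d) (E : set nat) (q : nat -> nat -> R)
    (P : nat -> probability Omega R) (X : R -> Omega -> option nat) : Prop :=
  exists (Y : nat -> {mfun Omega >-> nat}) (H : nat -> {mfun Omega >-> R}),
    [/\ forall n w, E (Y n w),
        forall n w, 0 < H n w,
        is_jump_path (fun n => Y n : Omega -> nat)
          (fun n => H n : Omega -> R) X &
        has_jump_law E q P (fun n => Y n : Omega -> nat)
          (fun n => H n : Omega -> R)].

Definition non_explosive (R : realType) (d : measure_display)
    (Omega : measurableType d) (r : nat)
    (P : nat -> probability Omega R) (X : R -> Omega -> option nat) : Prop :=
  forall (j : nat) (t : R), (r <= j)%N -> 0 <= t ->
    (\sum_(r <= n <oo) P j [set w | X t w = Some n])%E = 1%E.

Definition bd_rate (R : realType) (r : nat) (alpha beta : nat -> R)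
    (n m : nat) : R :=
  if (m == n.+1)%N then alpha n
  else if (r < n)%N && (m == n.-1) then beta n
  else 0.

Definition bd_catastrophe_rate (R : realType) (r : nat)
    (alpha beta : nat -> R) (xi : R) (n m : nat) : R :=
  if (m == n.+1)%N then alpha n
  else if (n == r.+1)%N then
    if (m == r)%N then beta r.+1 + xi else 0
  else if (r.+2 <= n)%N then
    if (m == n.-1)%N then beta n else if (m == r)%N then xi else 0
  else 0.

Definition passage_time (R : realType) (Omega : Type)
    (X : R -> Omega -> option nat) (k : nat) (w : Omega) : \bar R :=
  ereal_inf [set t%:E | t in [set t : R | 0 <= t /\ X t w = Some k]].

Definition passage_density (R : realType) (d : measure_display)
    (Omega : measurableType d) (P : nat -> probability Omega R)
    (X : R -> Omega -> option nat) (j k : nat) : R -> R :=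
  derive1 (fun t : R => fine (P j [set w | (passage_time X k w <= t%:E)%E])).

Definition passage_laplace (R : realType) (d : measure_display)
    (Omega : measurableType d) (P : nat -> probability Omega R)
    (X : R -> Omega -> option nat) (j k : nat) (lambda : R) : R :=
  if j == k then 1
  else (\int[lebesgue_measure]_(t in `]0%R, +oo[)
         (expR (- (lambda * t)) * passage_density P X j k t))%R.

(* The library's 'E_P[_] and 'V_P[_] take real-valued random variables, while  *)
(* a passage time may take the value +oo.                                      *)
Definition ext_mean (R : realType) (d : measure_display)
    (Omega : measurableType d) (P : probability Omega R)
    (T : Omega -> \bar R) : \bar R :=
  (\int[P]_w T w)%E.

Definition ext_variance (R : realType) (d : measure_display)
    (Omega : measurableType d) (P : probability Omega R)
    (T : Omega -> \bar R) : \bar R :=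
  (\int[P]_w ((T w - ext_mean P T) ^+ 2))%E.

(* Main.v *)
Require Import Defs.
From HB Require Import structures.
From mathcomp Require Import all_boot all_order all_algebra.
From mathcomp Require Import all_classical all_reals all_analysis.
From mathcomp Require Import measurable_realfun ring lra zify.
Import Order.TTheory GRing.Theory Num.Theory.
Import numFieldNormedType.Exports.
Set Implicit Arguments.
Unset Strict Implicit.
Unset Printing Implicit Defensive.
Local Open Scope classical_set_scope.
Local Open Scope ring_scope.

(* The law of the jump chain and holding times gives, for every finite path,   *)
(* the Laplace transform of its duration, so the transform of a hitting time   *)
(* is a sum of iterates of a killed one-step operator: it solves the           *)
(* first-step equations, and for a non-explosive chain it is their only        *)
(* bounded solution.  If phi_j(lam) is the transform of T_{j,k}, then          *)
(* phi_j - xi phi_r / (lam + xi) solves the equations at lam + xi of the       *)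
(* chain without catastrophes, whence                                          *)
(*   1 - phi_j(lam) = lam rho(lam),                                            *)
(*   rho(lam) = (1 - gamma_j(xi + lam)) / (lam + xi gamma_r(xi + lam)).        *)
(* As (1 - exp(-lam T)) / lam <= T and tends to T when lam tends to 0, Fatou's *)
(* lemma gives E T = rho(0) and E T^2 = - 2 rho'(0).                           *)
(* That the integral defining gamma_j is the Laplace transform of the hitting  *)
(* time requires its distribution function F to be C^1 on t > 0: the first     *)
(* holding time is exponential and independent of the rest of the path, so     *)
(* F' = q (G - F), where q is the exit rate of j and G the distribution        *)
(* function of the remaining time, and G is continuous because the second      *)
(* holding time is exponential and independent of the rest as well.            *)

(** * Integrals over a countable partition and over finite paths *)

(** The chain with catastrophes is compared with the one without through their first-step equations.
    Let phi_i(lam) be the Laplace transform of the hitting time of k from i. Summing the weights of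
    finite paths ([integral_path], [integral_killed_step], [hit_laplace_series]) shows that phi is
    the Neumann series of Q = [killed_step] applied to the indicator of k. Hence phi_k = 1 and phi_i
    = (Q phi)_i for i != k ([hit_laplace_self], [hit_laplace_first_step]). For the non-explosive
    chain without catastrophes, Q^n 1 tends to 0 ([non_explosive_killed_step]), so every bounded
    solution u of the equations off k is u_k times the transform ([killed_step_unique]).

    By [catastrophe_shift], u_i = (lam + xi) phi_i - xi phi_r is such a solution at lam + xi. With
    gamma taken at lam + xi this reads (lam + xi) phi_i - xi phi_r = (lam + xi - xi phi_r) gamma_i.
    The case i = r determines phi_r, and the case i = j then gives 1 - phi_j(lam) = lam rho(lam) for
    an explicit rho. This rho is differentiable at 0, because gamma is differentiable at xi
    ([derivable_hit_laplace]) and gamma_r(xi) > 0 ([hit_laplace_gt0]).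

    The moments are read off rho(0) and rho'(0) by [laplace_mean], [laplace_second_moment] and
    [laplace_variance]. These work with a time that may be infinite and obtain its integrability as
    a result.

    There remains to identify the integral of exp(-lam t) against the derivative of the distribution
    function with the expectation of exp(-lam T); this is [passage_laplaceE]. It rests on the
    independence of a holding time from the rest of the path ([independent_holding_time]), which
    turns the distribution function into a convolution with an exponential density
    ([exponential_sum_cdf]). *)

Section partition.
Context d (T : measurableType d) (R : realType).
Variable mu : {measure set T -> \bar R}.

Lemma measurable_fiber (N : T -> nat) (n : nat) :
  measurable_fun setT N -> measurable [set w | N w = n].
Proof. by move=> mN; rewrite -[X in measurable X]setTI; exact: (mN _ [set n]). Qed.

Lemma bigcup_fiber (N : T -> nat) (D : set T) :
  D = \bigcup_n (D `&` [set w | N w = n]).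
Proof.
apply/seteqP; split => [w Dw|w [n _ []//]].
by exists (N w).
Qed.

Lemma trivIset_fiber (N : T -> nat) (D : set T) :
  trivIset setT (fun n => D `&` [set w | N w = n]).
Proof. by move=> m n _ _ [w [[_ /= <-] [_ /= <-]]]. Qed.

Lemma ge0_integral_fiber (N : T -> nat) (D : set T) (f : T -> \bar R) :
  measurable_fun setT N -> measurable D -> measurable_fun D f ->
  (forall w, D w -> 0 <= f w)%E ->
  (\int[mu]_(w in D) f w =
   \sum_(n <oo) \int[mu]_(w in D `&` [set w | N w = n]) f w)%E.
Proof.
move=> mN mD mf f0; rewrite {1}(bigcup_fiber N D) ge0_integral_bigcup -?bigcup_fiber//.
  by move=> n; apply: measurableI => //; exact: measurable_fiber.
exact: trivIset_fiber.
Qed.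

Lemma eq_integral_fiber (N : T -> nat) (D D' : set T) (f g : T -> \bar R) :
  measurable_fun setT N -> measurable D -> measurable D' ->
  measurable_fun D f -> measurable_fun D' g ->
  (forall w, D w -> 0 <= f w)%E -> (forall w, D' w -> 0 <= g w)%E ->
  (forall n, \int[mu]_(w in D `&` [set w | N w = n]) f w =
             \int[mu]_(w in D' `&` [set w | N w = n]) g w)%E ->
  (\int[mu]_(w in D) f w = \int[mu]_(w in D') g w)%E.
Proof.
move=> mN mD mD' mf mg f0 g0 fg.
rewrite (ge0_integral_fiber mN mD mf f0) (ge0_integral_fiber mN mD' mg g0).
by apply: eq_eseriesr => n _; exact: fg.
Qed.

(** Serves for sums of a random number of holding times, the number being a hitting index. *)
Lemma measurable_fun_fiber d' (T' : measurableType d') (N : T -> nat)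
    (f : nat -> T -> T') :
  measurable_fun setT N -> (forall n, measurable_fun setT (f n)) ->
  measurable_fun setT (fun w => f (N w) w).
Proof.
move=> mN mf _ B mB; rewrite setTI.
rewrite (bigcup_fiber N (_ @^-1` _)); apply: bigcup_measurable => n _.
rewrite (_ : _ `&` _ = (f n @^-1` B) `&` [set w | N w = n]); last first.
  by apply/seteqP; split => w /= [] + Nw; rewrite Nw.
apply: measurableI; last exact: measurable_fiber.
by rewrite -[X in measurable X]setTI; exact: mf.
Qed.

End partition.

Definition path_event {T : Type} (Y : nat -> T -> nat) (i : nat -> nat) (n : nat) :=
  [set w | forall m, (m <= n)%N -> Y m w = i m].

Section paths.
Context d (T : measurableType d) (R : realType).
Variable mu : {measure set T -> \bar R}.
Variable Y : nat -> T -> nat.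
Hypothesis mY : forall n, measurable_fun setT (Y n).

Lemma measurable_path_event i n : measurable (path_event Y i n).
Proof.
rewrite (_ : path_event Y i n = \bigcap_(m in [set m | (m <= n)%N]) [set w | Y m w = i m])//.
by apply: bigcap_measurable => [|m _]; [exists 0%N|exact: measurable_fiber].
Qed.

Lemma path_eventS i n l :
  path_event Y i n `&` [set w | Y n.+1 w = l] =
  path_event Y (fun m => if m == n.+1 then l else i m) n.+1.
Proof.
apply/seteqP; split => w /=.
  move=> [p pn] m; rewrite leq_eqVlt => /predU1P[->|mn]; first by rewrite eqxx.
  by rewrite ltn_eqF// p.
move=> p; split; last by rewrite p// eqxx.
by move=> m mn; rewrite p ?(leq_trans mn)// ltn_eqF.
Qed.

(** Splitting along one more coordinate of [Y] at each induction step reduces an equality of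
    integrals to the events of a prescribed finite path, which are those whose probabilities
    [has_jump_law] gives. *)
Lemma eq_integral_path (n : nat) (D D' : set T) (f g : T -> \bar R) :
  measurable D -> measurable D' -> measurable_fun D f -> measurable_fun D' g ->
  (forall w, D w -> 0 <= f w)%E -> (forall w, D' w -> 0 <= g w)%E ->
  (forall i, \int[mu]_(w in D `&` path_event Y i n) f w =
             \int[mu]_(w in D' `&` path_event Y i n) g w)%E ->
  (\int[mu]_(w in D) f w = \int[mu]_(w in D') g w)%E.
Proof.
move=> mD mD' mf mg f0 g0.
elim: n => [|n IH] fg.
  apply: (eq_integral_fiber (mY 0)) => // l.
  have := fg (fun=> l); congr (_ = _); congr (integral _ _ _); congr (_ `&` _);
    by apply/seteqP; split => w /= => [/(_ 0%N)->//|p m]; rewrite leqn0 => /eqP->.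
apply: IH => i; apply: (eq_integral_fiber (mY n.+1)) => //.
- by apply: measurableI => //; exact: measurable_path_event.
- by apply: measurableI => //; exact: measurable_path_event.
- exact: measurable_funS mf.
- exact: measurable_funS mg.
- by move=> w [? _]; exact: f0.
- by move=> w [? _]; exact: g0.
- by move=> l; rewrite -!setIA !path_eventS; exact: fg.
Qed.

End paths.

(** * Laplace transforms *)

Section exponential_integrals.
Context {R : realType}.
Notation mu := (@lebesgue_measure R).

Lemma is_derive_expRZ (a x : R) :
  is_derive x (1 : R) (fun t : R => expR (a * t)) (a * expR (a * x)).
Proof.
have dl : is_derive x (1 : R) (fun t : R => a * t) a.
  by apply: is_derive_eq; rewrite [LHS]mulr1.
rewrite mulrC; exact: (@is_derive1_comp _ expR (fun t : R => a * t) x).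
Qed.

Lemma continuous_expRZ (a : R) : continuous (fun t : R => expR (a * t)).
Proof.
move=> x; apply: differentiable_continuous; apply/derivable1_diffP.
by have [] := is_derive_expRZ a x.
Qed.

Lemma measurable_expRZ (a : R) D : measurable_fun D (fun t : R => expR (a * t)).
Proof. by apply: measurableT_comp => //; exact: mulrl_measurable. Qed.

Lemma integral_expR_tail (lam x : R) : 0 < lam ->
  (\int[mu]_(t in `[x, +oo[) (lam * expR (- lam * t))%:E = (expR (- lam * x))%:E)%E.
Proof.
move=> lam0.
have dF t : is_derive t (1 : R) (fun t : R => - expR (- lam * t)) (lam * expR (- lam * t)).
  by apply: is_derive_eq; rewrite [_ *: 1]mulr1; ring.
rewrite (@ge0_continuous_FTC2y _ _ (fun t => - expR (- lam * t)) _ 0).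
- by rewrite sub0e -EFinN opprK.
- by move=> t _; rewrite mulr_ge0 ?expR_ge0 ?(ltW lam0).
- apply: continuous_subspaceT => t.
  by apply: cvgM; [exact: cvg_cst|exact: continuous_expRZ].
- rewrite -oppr0; apply: cvgN.
  rewrite (_ : (fun x => _) = (fun z => expR (- z)) \o (fun z => lam * z)).
    by apply: (@cvg_comp _ _ _ _ _ _ (pinfty_nbhs R)); [exact: gt0_cvgMry|exact: cvgr_expR].
  by apply: eq_fun => t; rewrite mulNr.
- by move=> t _; have [] := dF t.
- apply: cvg_at_right_filter; apply: cvgN; exact: continuous_expRZ.
- by move=> t _; rewrite derive1E; have [] := dF t.
Qed.

End exponential_integrals.

Section laplace.
Context d (T : measurableType d) (R : realType) (P : probability T R).
Notation mu := (@lebesgue_measure R).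

(** Both sides integrate f(w) h(t) over the region S w <= t of the product of [P] and Lebesgue
    measure, in the two orders. *)
Lemma tonelli_cdf (D : set T) (f S : T -> R) (I : set R) (h : R -> R) :
  measurable D -> measurable_fun setT f -> measurable_fun setT S ->
  measurable I -> measurable_fun setT h ->
  (forall w, 0 <= f w) -> (forall t, 0 <= h t) ->
  (\int[P]_(w in D) ((f w)%:E * \int[mu]_(t in I `&` `[S w, +oo[) (h t)%:E) =
   \int[mu]_(t in I) ((h t)%:E * \int[P]_(w in D `&` [set w | (S w <= t)%R]) (f w)%:E))%E.
Proof.
move=> mD mf mS mI mh f0 h0.
pose g (z : T * R) : \bar R :=
  (\1_D z.1 * f z.1 * (\1_[set z : T * R | S z.1 <= z.2] z * (\1_I z.2 * h z.2)))%:E.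
have mSle (t : R) : measurable [set w | S w <= t].
  by rewrite -[X in measurable X]setTI -preimage_itvNyc; exact: mS.
have mg : measurable_fun setT g.
  apply/measurable_EFinP; apply: measurable_funM.
    by apply: measurable_funM; apply: measurableT_comp => //; exact: measurable_indic.
  apply: measurable_funM.
    apply: measurable_indic.
    rewrite (_ : [set _ | _] = setT `&` (fun z : T * R => z.2 - S z.1) @^-1` `[0%R, +oo[).
      have m : measurable_fun setT (fun z : T * R => z.2 - S z.1).
        by apply: measurable_funB => //; exact: measurableT_comp.
      exact: m.
    by rewrite setTI; apply/seteqP; split => z /=; rewrite in_itv/= andbT subr_ge0.
  apply: measurable_funM.
    by apply: measurableT_comp => //; exact: measurable_indic.
  exact: measurableT_comp.
have g0 z : (0 <= g z)%E.
  by rewrite lee_fin !mulr_ge0 ?indicE ?ler0n.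
have mem_Sle (w : T) (t : R) :
    ((w, t) \in [set z : T * R | S z.1 <= z.2]) = (S w <= t).
  by apply/idP/idP; rewrite inE.
have := fubini_tonelli (m1 := P) (m2 := mu) g mg g0.
set l := (X in X = _); set r := (X in _ = X) => lr.
transitivity l.
  rewrite integral_mkcond; apply: eq_integral => w _.
  rewrite [LHS]patchE.
  transitivity ((\1_D w * f w)%:E * \int[mu]_(t in I `&` `[S w, +oo[) (h t)%:E)%E.
    by rewrite indicE; case: ifPn => wD; rewrite !(mul1r, mul0r, mul0e).
  rewrite [in LHS]integral_mkcond -ge0_integralZl//; first last.
  - by rewrite lee_fin mulr_ge0 // indicE.
  - by move=> t _; apply: erestrict_ge0 => s _; rewrite lee_fin.
  - apply/(measurable_restrictT _ _).1; first exact: measurableI.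
    by apply/measurable_EFinP; exact: measurable_funTS.
  apply: eq_integral => t _; rewrite patchE in_setI mem_setE in_itv/= andbT /g/= !indicE mem_Sle.
  case: leP => St /=; last by rewrite andbF mul0r mulr0 mule0.
  by rewrite andbT mul1r; case: (t \in I); rewrite ?mul1r ?mul0r ?mulr0 ?mule0 // EFinM.
rewrite lr /r [RHS]integral_mkcond; apply: eq_integral => t _.
rewrite [RHS]patchE; case: ifPn => tI; last first.
  apply: integral0_eq => w _; rewrite /g /= !indicE mem_Sle (negbTE tI).
  by rewrite !(mul0r, mulr0).
rewrite [in RHS]integral_mkcond -[RHS]ge0_integralZl//; first last.
- by rewrite lee_fin.
- by move=> w _; apply: erestrict_ge0 => s _; rewrite lee_fin.
- apply/(measurable_restrictT _ _).1; first exact: measurableI.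
  by apply/measurable_EFinP; exact: measurable_funTS.
apply: eq_integral => w _; rewrite /g patchE /= !indicE mem_Sle tI.
rewrite in_setI mul1r (_ : (w \in [set w | S w <= t]) = (S w <= t)); last by apply/idP/idP; rewrite inE.
case: (w \in D) => /=; case: leP => _; rewrite ?(mul1r, mul0r, mulr0, mule0) //.
by rewrite -EFinM mulrC.
Qed.

(** Uses that exp(-lam S) is the integral of lam exp(-lam t) over t >= S, which exchanges a Laplace
    transform for an integral of the distribution function. *)
Lemma laplace_tonelli (D : set T) (f S : T -> R) (lam : R) :
  0 < lam -> measurable D -> measurable_fun setT f -> measurable_fun setT S ->
  (forall w, 0 <= f w) -> (forall w, 0 <= S w) ->
  (\int[P]_(w in D) (f w * expR (- lam * S w))%:E =
   \int[mu]_(t in `[0%R, +oo[) ((lam * expR (- lam * t))%:E *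
      \int[P]_(w in D `&` [set w | (S w <= t)%R]) (f w)%:E))%E.
Proof.
move=> lam0 mD mf mS f0 S0.
rewrite -(@tonelli_cdf D f S `[0%R, +oo[%classic (fun t => lam * expR (- lam * t)))//.
- apply: eq_integral => w _.
  rewrite (_ : _ `&` _ = `[S w, +oo[%classic) ?integral_expR_tail// ?EFinM//.
  apply/seteqP; split => t /=; rewrite !in_itv/= !andbT; first by case.
  by move=> St; split=> //; exact: le_trans St.
- by apply: measurable_funM => //; exact: measurable_expRZ.
- by move=> t; rewrite mulr_ge0 ?expR_ge0 ?(ltW lam0).
Qed.

(* The hypothesis says that, under the finite measure f dP on D, H is          *)
(* exponential with rate q; the conclusion is its Laplace transform.           *)
Lemma laplace_exponential (D : set T) (f H : T -> R) (c q lam : R) :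
  0 < lam -> 0 <= q -> 0 <= c ->
  measurable D -> measurable_fun setT f -> measurable_fun setT H ->
  (forall w, 0 <= f w) -> (forall w, 0 < H w) ->
  (forall s : R, (0 <= s)%R ->
     \int[P]_(w in D `&` [set w | (s < H w)%R]) (f w)%:E = (c * expR (- q * s))%:E)%E ->
  (\int[P]_(w in D) (f w * expR (- lam * H w))%:E = (c * (q / (lam + q)))%:E)%E.
Proof.
move=> lam0 q0 c0 mD mf mH f0 H0 fH.
rewrite laplace_tonelli//; last by move=> w; exact: ltW.
have mlt (s : R) : measurable [set w | s < H w].
  by rewrite -[X in measurable X]setTI -preimage_itvoy; exact: mH.
have mle (s : R) : measurable [set w | H w <= s].
  by rewrite -[X in measurable X]setTI -preimage_itvNyc; exact: mH.
have fc : (\int[P]_(w in D) (f w)%:E = c%:E)%E.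
  rewrite -[c]mulr1 -expR0 -(mulr0 (- q)) -fH//; congr integral.
  by apply/seteqP; split => [w Dw|w []//]; split => //=.
have fle (s : R) : 0 <= s ->
    (\int[P]_(w in D `&` [set w | (H w <= s)%R]) (f w)%:E = (c - c * expR (- q * s))%:E)%E.
  move=> s0.
  have : (\int[P]_(w in (D `&` [set w | (H w <= s)%R]) `|` (D `&` [set w | (s < H w)%R]))
            (f w)%:E = c%:E)%E.
    rewrite -fc -setIUr; congr integral; apply/seteqP; split => [w []//|w Dw]; split=> //=.
    by case: (leP (H w) s) => ?; [left|right].
  rewrite ge0_integral_setU//=; first last.
  - by apply/disj_setPS => w /= [[_ /= a] [_ /=]]; rewrite ltNge a.
  - by move=> w _; rewrite lee_fin.
  - by apply/measurable_EFinP; exact: measurable_funTS.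
  - exact: measurableI.
  - exact: measurableI.
  rewrite fH// EFinB => <-; rewrite addeK//.
transitivity (\int[mu]_(t in `[0%R, +oo[)
    ((lam * expR (- lam * t))%:E * (c - c * expR (- q * t))%:E))%E.
  by apply: eq_integral => t; rewrite inE/= in_itv/= andbT => t0; rewrite fle.
have lq0 : 0 < lam + q by rewrite ltr_wpDr.
have mE (a b : R) : measurable_fun (`[0%R, +oo[%classic : set R)
    (fun t : R => (a * expR (b * t))%:E).
  by apply/measurable_EFinP; apply: measurable_funM => //; exact: measurable_expRZ.
(* The integrand is c times the Exp(lam) density minus c lam / (lam + q) times the Exp(lam + q)
   density. The subtracted term is moved to the left so that only nonnegative functions are
   added. *)
have split_sum : (\int[mu]_(t in `[0%R, +oo[)
    ((lam * expR (- lam * t))%:E * (c - c * expR (- q * t))%:E)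
   + \int[mu]_(t in `[0%R, +oo[) ((c * (lam / (lam + q)))%:E *
       ((lam + q) * expR (- (lam + q) * t))%:E)
   = \int[mu]_(t in `[0%R, +oo[) (c%:E * (lam * expR (- lam * t))%:E))%E.
  rewrite -ge0_integralD//.
  - apply: eq_integral => t _; rewrite -!EFinM -EFinD; congr EFin.
    have -> : expR (- (lam + q) * t) = expR (- lam * t) * expR (- q * t).
      by rewrite -expRD; congr expR; ring.
    by field; lra.
  - move=> t /=; rewrite in_itv/= andbT => t0; rewrite mule_ge0 ?lee_fin//.
      by rewrite mulr_ge0 ?expR_ge0 ?(ltW lam0).
    rewrite -[X in X - _]mulr1 -mulrBr mulr_ge0// subr_ge0 -expR0 ler_expR.
    by rewrite mulNr oppr_le0 mulr_ge0.
  - apply: emeasurable_funM; first exact: mE.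
    by apply/measurable_EFinP; apply: measurable_funB => //; apply/measurable_EFinP; exact: mE.
  - by move=> t _; rewrite -EFinM lee_fin !mulr_ge0 ?expR_ge0 ?invr_ge0 ?(ltW lam0) ?(ltW lq0).
  - by apply: emeasurable_funM => //; exact: mE.
move: split_sum.
rewrite ge0_integralZl//; [|exact: mE|by move=> t _; rewrite lee_fin mulr_ge0 ?expR_ge0 ?(ltW lq0)|
  by rewrite lee_fin mulr_ge0// divr_ge0 ?(ltW lam0) ?(ltW lq0)].
rewrite [in RHS]ge0_integralZl//; [|exact: mE|by move=> t _; rewrite lee_fin mulr_ge0 ?expR_ge0 ?(ltW lam0)].
rewrite !integral_expR_tail// !mulr0 expR0 !mule1 => h.
rewrite -[LHS](@addeK _ (c * (lam / (lam + q)))%:E)// h -EFinB; congr EFin.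
by field; lra.
Qed.

End laplace.

(** * Weighted jump chains *)

Lemma eseries_finite (R : realType) (u : nat -> R) (N : nat) :
  (forall l, (N <= l)%N -> u l = 0) ->
  (\sum_(0 <= l <oo) (u l)%:E = (\sum_(l < N) u l)%:E)%E.
Proof.
move=> u0; apply/cvg_lim => //; apply: cvg_near_cst; near=> n.
have Nn : (N <= n)%N by near: n; exact: nbhs_infty_ge.
rewrite sumEFin (big_cat_nat (leq0n N) Nn)/=.
have -> : \sum_(N <= i < n) u i = 0.
  by rewrite big_nat big1// => l /andP[? _]; exact: u0.
by rewrite addr0 big_mkord.
Unshelve. all: by end_near. Qed.

Lemma prodrM1 (R : comNzRingType) (n a : nat) (F G : nat -> R) (x : R) :
  (a < n)%N -> F a = G a * x -> (forall m, m != a -> F m = G m) ->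
  \prod_(m < n) F m = (\prod_(m < n) G m) * x.
Proof.
move=> an Fa FG.
rewrite (bigD1 (Ordinal an))//= [in RHS](bigD1 (Ordinal an))//= Fa mulrAC; congr (_ * _ * _).
by apply: eq_bigr => m ma; rewrite FG.
Qed.

(** What the two rate functions have in common. Upward jumps have size one, so every row is
    supported on {0, ..., i+1} and sums over targets are finite; downward jumps of any size are
    allowed, as catastrophes require. *)
Record local_rates (R : realType) (E : set nat) (q : nat -> nat -> R) : Prop := LocalRates {
  rate_ge0 : forall i m, E i -> 0 <= q i m;
  rate_diag : forall i, E i -> q i i = 0;
  rate_far : forall i m, E i -> (i.+1 < m)%N -> q i m = 0;
  rate_closed : forall i m, E i -> ~ E m -> q i m = 0;
  rate_up_gt0 : forall i, E i -> 0 < q i i.+1;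
  state_up : forall i, E i -> E i.+1 }.

Section rates.
Context (R : realType) (E : set nat) (q : nat -> nat -> R).
Hypothesis lq : local_rates E q.

Lemma exit_rateE i : E i -> exit_rate q i = \sum_(m < i.+2) q i m.
Proof.
move=> Ei; rewrite /exit_rate -[RHS]/(fine (\sum_(m < i.+2) q i m)%:E) -eseries_finite; last first.
  by move=> l il; rewrite (rate_far lq).
rewrite eseries_mkcond; congr fine; apply: eq_eseriesr => m _.
by case: eqP => //= ->; rewrite (rate_diag lq).
Qed.

Lemma exit_rate_gt0 i : E i -> 0 < exit_rate q i.
Proof.
move=> Ei; rewrite exit_rateE// big_ord_recr/=.
by rewrite ltr_wpDl ?(rate_up_gt0 lq)// sumr_ge0// => m _; rewrite (rate_ge0 lq).
Qed.

(* One step of the jump chain, weighted by the Laplace transform at lam of the *)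
(* holding time and killed on k.                                               *)
Definition killed_step (k : nat) (lam : R) (f : nat -> R) (i : nat) : R :=
  if i == k then 0
  else \sum_(m < i.+2) q i m / (lam + exit_rate q i) * f m.

Lemma killed_step_ge0 k lam f : 0 <= lam -> (forall i, E i -> 0 <= f i) ->
  forall i, E i -> 0 <= killed_step k lam f i.
Proof.
move=> lam0 f0 i Ei; rewrite /killed_step; case: ifP => // _.
apply: sumr_ge0 => m _; have [Em|Em] := pselect (E m).
  by rewrite mulr_ge0 ?f0// divr_ge0 ?(rate_ge0 lq)// addr_ge0// ltW// exit_rate_gt0.
by rewrite (rate_closed lq)// !mul0r.
Qed.

Lemma iter_killed_step_ge0 k lam f p : 0 <= lam -> (forall i, E i -> 0 <= f i) ->
  forall i, E i -> 0 <= iter p (killed_step k lam) f i.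
Proof. by move=> lam0 f0; elim: p => //= p IH; exact: killed_step_ge0. Qed.

End rates.

Definition not_hit {T : Type} (Y : nat -> T -> nat) (k p : nat) :=
  [set w | forall m, (m < p)%N -> Y m w <> k].

Section jump_law.
Context (R : realType) (E : set nat) (q : nat -> nat -> R).
Context d (Omega : measurableType d) (P : nat -> probability Omega R).
Variables (Y : nat -> Omega -> nat) (H : nat -> Omega -> R).
Hypothesis lq : local_rates E q.
Hypothesis mY : forall n, measurable_fun setT (Y n).
Hypothesis mH : forall n, measurable_fun setT (H n).
Hypothesis YE : forall n w, E (Y n w).
Hypothesis H_gt0 : forall n w, 0 < H n w.
Hypothesis law : has_jump_law E q P Y H.

Local Notation ex := (exit_rate q).

Lemma measurable_tail (n : nat) (s : R) : measurable [set w | s < H n w].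
Proof. by rewrite -[X in measurable X]setTI -preimage_itvoy; exact: mH. Qed.

Lemma measurable_tails (A : nat -> bool) (s : nat -> R) :
  measurable [set w | forall m, A m -> s m < H m w].
Proof.
rewrite (_ : mkset _ = \bigcap_(m in [set m | A m]) [set w | s m < H m w])//.
by apply: bigcap_measurableType => m _; exact: measurable_tail.
Qed.

(** The test against repeated states in [has_jump_law] disappears because the diagonal rates
    vanish. *)
Lemma jump_law_path (j n : nat) (i : nat -> nat) (s : nat -> R) :
  E j -> (forall m, (m <= n)%N -> E (i m)) -> (forall m, (m < n)%N -> 0 <= s m) ->
  P j (path_event Y i n `&` [set w | forall m, (m < n)%N -> s m < H m w]) =
  ((i 0%N == j)%:R *
     \prod_(m < n) (q (i m) (i m.+1) / ex (i m) * expR (- ex (i m) * s m)))%:E.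
Proof.
move=> Ej Ei s0; rewrite law//; congr (_ * _)%:E; apply: eq_bigr => m _.
rewrite mulNr; congr (_ * _); case: eqP => // ->.
by rewrite (rate_diag lq) ?mul0r//; apply: Ei; exact: ltnW.
Qed.

(** By induction on [a]: the holding times before [a] already contribute Laplace factors, while
    those from [a] on are still constrained by tail events. Letting the level at [a] vary shows that
    the a-th one is exponential under the weighted measure, and [laplace_exponential] turns its tail
    into a factor. *)
Lemma integral_path_tails (j n a : nat) (i : nat -> nat) (s : nat -> R) (lam : R) :
  E j -> (forall m, (m <= n)%N -> E (i m)) -> 0 < lam -> (a <= n)%N ->
  (forall m, 0 <= s m) ->
  (\int[P j]_(w in path_event Y i n `&`
      [set w | forall m, ((a <= m) && (m < n))%N -> (s m < H m w)%R])
    (\prod_(m < a) expR (- lam * H m w))%:E =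
  ((i 0%N == j)%:R * \prod_(m < n) (q (i m) (i m.+1) / ex (i m) *
     (if (m < a)%N then ex (i m) / (lam + ex (i m)) else expR (- ex (i m) * s m))))%:E)%E.
Proof.
move=> Ej Ei lam0; elim: a s => [s _ s0|a IH s an s0].
  rewrite (eq_integral (cst 1%E)); last by move=> w _; rewrite big_ord0.
  rewrite integral_cst; last first.
    apply: measurableI; first exact: measurable_path_event.
    exact: (measurable_tails (fun m => (m < n)%N)).
  by rewrite mul1e; exact: jump_law_path.
have Ea : E (i a) by apply: Ei; exact: ltnW.
have exa := exit_rate_gt0 lq Ea.
(* The factors with the a-th tail event removed, that is, with tail probability 1 at [a]. *)
pose F m := q (i m) (i m.+1) / ex (i m) *
     (if (m < a)%N then ex (i m) / (lam + ex (i m)) else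
      if m == a then 1 else expR (- ex (i m) * s m)).
transitivity (((i 0%N == j)%:R * \prod_(m < n) F m) * (ex (i a) / (lam + ex (i a))))%:E; last first.
  congr EFin; rewrite -mulrA; congr (_ * _); symmetry.
  apply: (@prodrM1 _ n a (fun m => q (i m) (i m.+1) / ex (i m) *
     (if (m < a.+1)%N then ex (i m) / (lam + ex (i m)) else expR (- ex (i m) * s m))) F) => //; rewrite /F.
    by rewrite ltnS leqnn ltnn eqxx mulr1.
  by move=> m ma; rewrite ltnS leq_eqVlt (negbTE ma).
under eq_integral do rewrite big_ord_recr/=.
apply: laplace_exponential => //.
- exact: ltW.
- rewrite mulr_ge0// prodr_ge0// => m _.
  have Em : E (i m) by apply: Ei; exact: ltnW.
  have exm := ltW (exit_rate_gt0 lq Em).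
  rewrite /F mulr_ge0 ?divr_ge0 ?(rate_ge0 lq)//.
  by case: ifP => _; [rewrite divr_ge0// addr_ge0// ltW|case: ifP => //; rewrite expR_ge0].
- apply: measurableI; first exact: measurable_path_event.
  exact: (measurable_tails (fun m => (a < m) && (m < n))%N).
- apply: measurable_prod => m _; apply: measurableT_comp => //.
  exact: measurable_funM.
- by move=> w; rewrite prodr_ge0// => m _; exact: expR_ge0.
move=> t t0; pose s' m := if m == a then t else s m.
have := IH s' (ltnW an); rewrite /s' => {}IH.
transitivity (\int[P j]_(w in path_event Y i n `&`
      [set w | forall m, ((a <= m) && (m < n))%N -> (s' m < H m w)%R])
    (\prod_(m < a) expR (- lam * H m w))%:E)%E.
  congr integral; rewrite -setIA; congr (_ `&` _); apply/seteqP; split => w /=.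
    move=> [h1 h2] m /andP[am mn]; rewrite /s'; case: eqP => [->//|/eqP ma].
    by apply: h1; rewrite mn andbT ltn_neqAle eq_sym ma.
  move=> h; split => [m /andP[am mn]|].
    by have := h m; rewrite /s' gtn_eqF// mn (ltnW am); exact.
  by have := h a; rewrite /s' eqxx leqnn an; exact.
rewrite IH; last by move=> m; case: ifP.
congr EFin; rewrite -mulrA; congr (_ * _).
apply: (@prodrM1 _ n a (fun m => q (i m) (i m.+1) / ex (i m) *
   (if (m < a)%N then ex (i m) / (lam + ex (i m)) else expR (- ex (i m) * if m == a then t else s m))) F) => //; rewrite /F.
  by rewrite ltnn eqxx mulr1.
by move=> m ma; rewrite (negbTE ma).
Qed.

(** The case [a = n], with no tail event left; the exit rate in each jump probability cancels
    against the numerator of the Laplace factor. *)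
Lemma integral_path (j n : nat) (i : nat -> nat) (lam : R) :
  E j -> (forall m, (m <= n)%N -> E (i m)) -> 0 < lam ->
  (\int[P j]_(w in path_event Y i n) (expR (- lam * jump_time H n w))%:E =
  ((i 0%N == j)%:R * \prod_(m < n) (q (i m) (i m.+1) / (lam + ex (i m))))%:E)%E.
Proof.
move=> Ej Ei lam0.
have := @integral_path_tails j n n i (fun=> 0) lam Ej Ei lam0 (leqnn n) (fun=> lexx 0).
rewrite (_ : [set w | _] = setT); last first.
  by apply/seteqP; split => // w _ m /andP[nm mn]; move: (leq_trans mn nm); rewrite ltnn.
rewrite setIT => h; transitivity (\int[P j]_(w in path_event Y i n) (\prod_(m < n) expR (- lam * H m w))%:E)%E.
  by apply: eq_integral => w _; rewrite /jump_time mulr_sumr expR_sum.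
rewrite h; congr (_ * _)%:E; apply: eq_bigr => m _; rewrite ltn_ord.
have Em : E (i m) by apply: Ei; exact: ltnW.
have exm := exit_rate_gt0 lq Em.
by field; rewrite !gt_eqF ?addr_gt0.
Qed.

Lemma measurable_jump_time n : measurable_fun setT (jump_time H n).
Proof. by apply: measurable_sum => m; exact: mH. Qed.

Lemma measurable_not_hit k p : measurable (not_hit Y k p).
Proof.
rewrite (_ : not_hit Y k p = \bigcap_(m in [set m | (m < p)%N]) ~` [set w | Y m w = k])//.
by apply: bigcap_measurableType => m _; apply: measurableC; exact: measurable_fiber.
Qed.

(** On a fixed path up to time p, summing over the next state is one application of the operator.
    Paths through k before p contribute to neither side, and for a path at k at time p the left
    domain is empty while [killed_step] vanishes at k. *)
Lemma integral_killed_stepS (k j p : nat) (lam : R) (f : nat -> R) :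
  E j -> 0 < lam -> (forall i, E i -> 0 <= f i) ->
  (\int[P j]_(w in not_hit Y k p.+1) (expR (- lam * jump_time H p.+1 w) * f (Y p.+1 w))%:E =
   \int[P j]_(w in not_hit Y k p)
     (expR (- lam * jump_time H p w) * killed_step q k lam f (Y p w))%:E)%E.
Proof.
move=> Ej lam0 f0.
have mg n (g : nat -> R) : measurable_fun setT (fun w => expR (- lam * jump_time H n w) * g (Y n w)).
  apply: measurable_funM; last by apply: measurableT_comp.
  by apply: measurableT_comp => //; apply: measurable_funM => //; exact: measurable_jump_time.
have kf0 := killed_step_ge0 lq k (ltW lam0) f0.
apply: (eq_integral_path mY (n := p)).
- exact: measurable_not_hit.
- exact: measurable_not_hit.
- by apply/measurable_EFinP; apply: measurable_funTS; exact: mg.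
- by apply/measurable_EFinP; apply: measurable_funTS; exact: mg.
- by move=> w _; rewrite lee_fin mulr_ge0 ?expR_ge0 ?f0.
- by move=> w _; rewrite lee_fin mulr_ge0 ?expR_ge0 ?kf0.
move=> i.
have [[m mp imk]|ik] := pselect (exists2 m, (m < p)%N & i m = k).
  have dis p' : (m < p')%N -> not_hit Y k p' `&` path_event Y i p = set0.
    move=> mp'; apply/seteqP; split => // w [/= h] /(_ m (ltnW mp)); rewrite imk.
    exact: h.
  by rewrite !dis ?integral_set0// ltnW.
have dp : not_hit Y k p `&` path_event Y i p = path_event Y i p.
  apply/seteqP; split => [w []//|w pw]; split=> // m mp.
  by rewrite pw ?(ltnW mp)// => imk; apply: ik; exists m.
rewrite dp; have [ipk|/eqP ipk] := eqVneq (i p) k.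
  rewrite (_ : not_hit _ _ _ `&` _ = set0) ?integral_set0; last first.
    by apply/seteqP; split => // w [/= h] /(_ p (leqnn _)); rewrite ipk; exact: h.
  rewrite integral0_eq// => w pw; rewrite pw// ipk /killed_step eqxx mulr0//.
have -> : not_hit Y k p.+1 `&` path_event Y i p = path_event Y i p.
  rewrite -[RHS]dp; apply/seteqP; split => w [h pw]; split=> // m mp.
    by apply: h; exact: leq_trans mp _.
  move: mp; rewrite ltnS leq_eqVlt => /predU1P[->|mp]; last exact: h.
  by rewrite pw.
have [Ei|nEi] := pselect (forall m, (m <= p)%N -> E (i m)); last first.
  rewrite (_ : path_event Y i p = set0) ?integral_set0//.
  by apply/seteqP; split => // w pw; apply: nEi => m mp; rewrite -(pw m mp).
rewrite (ge0_integral_fiber _ (mY p.+1)).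
(* [c] is the weight of the path up to p; the next jump to l multiplies it by q(i p, l) / (lam +
   exit rate). *)
- set c := (i 0%N == j)%:R * \prod_(m < p) (q (i m) (i m.+1) / (lam + ex (i m))).
  have c0 : 0 <= c.
    rewrite /c mulr_ge0// prodr_ge0// => m _.
    by rewrite divr_ge0 ?(rate_ge0 lq) ?addr_ge0 ?(ltW lam0)// ?(ltW (exit_rate_gt0 lq _))//;
      apply: Ei; exact: ltnW.
  transitivity (\sum_(0 <= l <oo) (c * (q (i p) l / (lam + ex (i p)) * f l))%:E)%E.
    apply: eq_eseriesr => l _; rewrite path_eventS.
    have [El|El] := pselect (E l); last first.
      rewrite (rate_closed lq)//; last exact: Ei.
      rewrite !mul0r mulr0 (_ : path_event _ _ _ = set0) ?integral_set0//.
      by apply/seteqP; split => // w /(_ _ (leqnn _)); rewrite eqxx => h; apply: El; rewrite -h.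
    transitivity (\int[P j]_(w in path_event Y (fun m => if m == p.+1 then l else i m) p.+1)
      ((f l)%:E * (expR (- lam * jump_time H p.+1 w))%:E))%E.
      apply: eq_integral => w; rewrite inE => pw.
      by rewrite -EFinM mulrC pw// eqxx.
    rewrite ge0_integralZl//; first last.
    - by rewrite lee_fin f0.
    - apply/measurable_EFinP; apply: measurable_funTS; apply: measurableT_comp => //.
      by apply: measurable_funM => //; exact: measurable_jump_time.
    - exact: measurable_path_event.
    rewrite integral_path//; last by move=> m mp; case: eqP => // /eqP ne; apply: Ei;
       rewrite -ltnS ltn_neqAle ne.
    rewrite -EFinM; congr EFin; rewrite /= big_ord_recr/= eqxx (ltn_eqF (ltnSn p)) /c.
    under eq_bigr => m _ do rewrite !ltn_eqF ?ltnS ?(ltnW (ltn_ord m))//.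
    by ring.
  rewrite (@eseries_finite _ (fun l => c * (q (i p) l / (lam + ex (i p)) * f l)) (i p).+2); last first.
    by move=> l il; rewrite (rate_far lq) ?mul0r ?mulr0//; exact: Ei.
  transitivity (\int[P j]_(w in path_event Y i p)
    ((killed_step q k lam f (i p))%:E * (expR (- lam * jump_time H p w))%:E))%E; last first.
    by apply: eq_integral => w; rewrite inE => pw; rewrite -EFinM mulrC pw.
  rewrite ge0_integralZl//; first last.
  - by rewrite lee_fin kf0//; exact: Ei.
  - apply/measurable_EFinP; apply: measurable_funTS; apply: measurableT_comp => //.
    by apply: measurable_funM => //; exact: measurable_jump_time.
  - exact: measurable_path_event.
  rewrite integral_path// -EFinM; congr EFin; rewrite /killed_step.
  by move/eqP/negbTE : ipk => ->; rewrite -mulr_sumr mulrC.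
- exact: measurable_path_event.
- by apply/measurable_EFinP; apply: measurable_funTS; exact: mg.
- by move=> w _; rewrite lee_fin mulr_ge0 ?expR_ge0 ?f0.
Qed.

(** A Feynman-Kac formula: iterates of the operator are expectations over the paths that avoid k
    during the first p steps. For the indicator of k this isolates a first hit at step p; for the
    constant 1 it measures how much mass has neither been killed nor discounted. *)
Lemma integral_killed_step (k j p : nat) (lam : R) (f : nat -> R) :
  E j -> 0 < lam -> (forall i, E i -> 0 <= f i) ->
  (\int[P j]_(w in not_hit Y k p) (expR (- lam * jump_time H p w) * f (Y p w))%:E =
   (iter p (killed_step q k lam) f j)%:E)%E.
Proof.
move=> Ej lam0; elim: p f => [|p IH] f f0.
  have -> : not_hit Y k 0 = setT by apply/seteqP; split.
  have Y0 : (P j (path_event Y (fun=> j) 0) = 1)%E.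
    have := @jump_law_path j 0 (fun=> j) (fun=> 0) Ej (fun _ _ => Ej) (fun _ _ => lexx 0).
    rewrite eqxx big_ord0 mulr1 (_ : [set w | _] = setT) ?setIT//.
    by apply/seteqP; split.
  transitivity (\int[P j]_w (cst (f j)%:E w))%E; last first.
    by rewrite integral_cst// [X in (_ * X)%E](probability_setT (P j)) mule1.
  apply: ae_eq_integral => //.
    apply/measurable_EFinP; apply: measurable_funM; last exact: measurableT_comp.
    by apply: measurableT_comp => //; apply: measurable_funM => //; exact: measurable_jump_time.
  exists (~` path_event Y (fun=> j) 0); split.
  - by apply: measurableC; exact: measurable_path_event.
  - rewrite [LHS](probability_setC (P j)) ?Y0 ?subee//; exact: measurable_path_event.
  (* The initial state is j only almost surely, hence the detour through an almost everywhere
     equality. *)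
  move=> w /= h p; apply: h => _; rewrite /jump_time big_ord0 mulr0 expR0 mul1r.
  by rewrite p.
rewrite integral_killed_stepS// IH ?iterSr//.
by apply: (killed_step_ge0 lq) => //; exact: ltW.
Qed.

End jump_law.

(** * Hitting times *)

Section hitting.
Context (T : Type) (Y : nat -> T -> nat) (k : nat).

Definition hit_event := [set w | exists n, Y n w = k].

(* Junk value 0 where [k] is never hit. *)
Definition hit_index (w : T) : nat :=
  if pselect (exists n, Y n w == k) is left e then ex_minn e else 0%N.

Lemma hit_indexE n w : Y n w = k -> not_hit Y k n w -> hit_index w = n.
Proof.
move=> Yn nh; rewrite /hit_index; case: pselect => [e|[]]; last by exists n; apply/eqP.
case: ex_minnP => m /eqP Ym /(_ n); rewrite Yn eqxx => /(_ isT) mn.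
by apply/eqP; rewrite eqn_leq mn leqNgt; apply/negP => /nh.
Qed.

Lemma hit_indexP w : hit_event w ->
  Y (hit_index w) w = k /\ not_hit Y k (hit_index w) w.
Proof.
move=> [n Yn]; rewrite /hit_index; case: pselect => [e|[]]; last by exists n; apply/eqP.
case: ex_minnP => m /eqP Ym mn; split => // l lm /eqP Yl.
by move: (mn _ Yl); rewrite leqNgt lm.
Qed.

Lemma hit_event_index p :
  hit_event `&` [set w | hit_index w = p] = not_hit Y k p `&` [set w | Y p w = k].
Proof.
apply/seteqP; split => w /=.
  by move=> [/hit_indexP[? ?]] <-.
by move=> [nh Yp]; split; [exists p|exact: hit_indexE].
Qed.

End hitting.

Section measurable_hitting.
Context d (T : measurableType d) (Y : nat -> T -> nat) (k : nat).
Hypothesis mY : forall n, measurable_fun setT (Y n).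

Lemma measurable_hit_event : measurable (hit_event Y k).
Proof.
rewrite (_ : hit_event Y k = \bigcup_n [set w | Y n w = k]).
  by apply: bigcup_measurable => n _; exact: measurable_fiber.
by apply/seteqP; split => [w [n Yn]|w [n _ Yn]]; exists n.
Qed.

Lemma measurable_hit_index : measurable_fun setT (hit_index Y k).
Proof.
have mI n : measurable (hit_event Y k `&` [set w | hit_index Y k w = n]).
  rewrite hit_event_index; apply: measurableI; last exact: measurable_fiber.
  exact: measurable_not_hit.
have mF n : measurable [set w | hit_index Y k w = n].
  rewrite (_ : mkset _ = (hit_event Y k `&` [set w | hit_index Y k w = n]) `|`
     (~` hit_event Y k `&` [set w | n = 0%N])).
    apply: measurableU => //; apply: measurableI; first by apply: measurableC; exact: measurable_hit_event.
    case: (pselect (n = 0%N)) => n0; first by rewrite (_ : mkset _ = setT)//; apply/seteqP; split.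
    rewrite (_ : mkset _ = set0)//; apply/seteqP; split => // w /=.
  apply/seteqP; split => w /=.
    move=> wn; have [hw|nhw] := pselect (hit_event Y k w); [by left|right; split => //].
    rewrite -wn /hit_index; case: pselect => [e|//]; case: (e) => [m Ym].
    by exfalso; apply: nhw; exists m; apply/eqP.
  move=> [[]//|[nhw ->]]; rewrite /hit_index; case: pselect => [e|//]; case: (e) => [m Ym].
  by exfalso; apply: nhw; exists m; apply/eqP.
move=> _ B _; rewrite setTI (_ : _ @^-1` B = \bigcup_(n in B) [set w | hit_index Y k w = n]).
  by apply: bigcup_measurable => n _; exact: mF.
apply/seteqP; split => [w Bw|w [n Bn /= ->]//].
by exists (hit_index Y k w).
Qed.

End measurable_hitting.

(** Meaningful on [hit_event] only; elsewhere the index is 0 and so is the time. *)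
Definition hit_time (R : realType) (T : Type) (Y : nat -> T -> nat)
    (H : nat -> T -> R) (k : nat) (w : T) : R :=
  jump_time H (hit_index Y k w) w.

Section passage.
Context (R : realType) (T : Type) (Y : nat -> T -> nat) (H : nat -> T -> R).
Variable X : R -> T -> option nat.
Hypothesis H_gt0 : forall n w, 0 < H n w.
Hypothesis pathX : is_jump_path Y H X.

Lemma jump_timeS n w : jump_time H n.+1 w = jump_time H n w + H n w.
Proof. by rewrite /jump_time big_ord_recr. Qed.

Lemma jump_time_lt n w : jump_time H n w < jump_time H n.+1 w.
Proof. by rewrite jump_timeS ltrDl. Qed.

Lemma jump_time_le m n w : (m <= n)%N -> jump_time H m w <= jump_time H n w.
Proof.
move=> mn; rewrite -(subnKC mn); elim: (n - m)%N => [|p IH]; first by rewrite addn0.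
by rewrite addnS (le_trans IH)// ltW// jump_time_lt.
Qed.

Lemma jump_time_ge0 n w : 0 <= jump_time H n w.
Proof. by apply: sumr_ge0 => m _; exact: ltW. Qed.

(** A path with a state at time t has not exploded by t, so some jump time exceeds t; descending
    from it finds the holding interval that contains t. *)
Lemma jump_path_Some t w n : 0 <= t -> X t w = Some n ->
  exists2 m, jump_time H m w <= t < jump_time H m.+1 w & Y m w = n.
Proof.
move=> t0 Xt; have [m jm] : exists m, ~ jump_time H m w <= t.
  by apply/existsNP => h; move: (pathX.2 _ _ h); rewrite Xt.
have {m jm} : exists m, jump_time H m w <= t < jump_time H m.+1 w.
  elim: m jm => [|m IH] jm; first by exfalso; apply: jm; rewrite /jump_time big_ord0.
  case: (leP (jump_time H m w) t) => [h|h]; last by apply: IH; apply/negP; rewrite -ltNge.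
  by exists m; rewrite h/= ltNge; apply/negP.
move=> [m jm]; exists m => //.
by have := pathX.1 _ _ _ jm; rewrite Xt => -[].
Qed.

(** The infimum is attained at the jump into k, since paths are right-continuous and jump times
    increase. A path that explodes before visiting k is in state [None] afterwards, so its passage
    time is infinite. *)
Lemma passage_timeE k w :
  passage_time X k w = if w \in hit_event Y k then (hit_time Y H k w)%:E else +oo%E.
Proof.
rewrite /passage_time; case: ifPn => [/set_mem|/negP] hw; last first.
  rewrite (_ : [set _ | _ in _] = set0) ?ereal_inf0//.
  apply/seteqP; split => // x [t [t0 Xt] tx]; apply: hw; apply/mem_set.
  by have [m _ Ym] := jump_path_Some t0 Xt; exists m.
have [Yk nh] := hit_indexP hw.
apply/eqP; rewrite eq_le; apply/andP; split.
  apply: ereal_inf_lbound; exists (hit_time Y H k w) => //; split; first exact: jump_time_ge0.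
  have := pathX.1 (hit_index Y k w) (hit_time Y H k w) w; rewrite Yk; apply.
  by rewrite /hit_time lexx jump_time_lt.
apply: le_ereal_inf_tmp => _ [t [t0 Xt] <-]; rewrite lee_fin.
have [m /andP[jm _] Ym] := jump_path_Some t0 Xt.
apply: le_trans jm; apply: jump_time_le; rewrite leqNgt; apply/negP => /nh.
by rewrite Ym.
Qed.

Lemma hit_time_ge0 k w : 0 <= hit_time Y H k w.
Proof. exact: jump_time_ge0. Qed.

End passage.

(** * Uniqueness of bounded solutions of the first-step equations *)

Section killed_step_algebra.
Context (R : realType) (E : set nat) (q : nat -> nat -> R).
Hypothesis lq : local_rates E q.
Variables (k : nat) (lam : R).
Hypothesis lam_ge0 : 0 <= lam.
Local Notation Q := (killed_step q k lam).

Lemma eq_killed_step f g : (forall i, E i -> f i = g i) -> forall i, E i -> Q f i = Q g i.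
Proof.
move=> fg i Ei; rewrite /killed_step; case: ifP => // _; apply: eq_bigr => m _.
by have [Em|Em] := pselect (E m); [rewrite fg|rewrite (rate_closed lq)// !mul0r].
Qed.

Lemma killed_stepD f g i : Q (fun m => f m + g m) i = Q f i + Q g i.
Proof.
rewrite /killed_step; case: ifP => _; first by rewrite addr0.
by rewrite -big_split; apply: eq_bigr => m _; rewrite mulrDr.
Qed.

Lemma killed_stepZ c f i : Q (fun m => c * f m) i = c * Q f i.
Proof.
rewrite /killed_step; case: ifP => _; first by rewrite mulr0.
by rewrite mulr_sumr; apply: eq_bigr => m _; rewrite mulrCA.
Qed.

Lemma killed_step_sum n (f : nat -> nat -> R) i :
  Q (fun m => \sum_(p < n) f p m) i = \sum_(p < n) Q (f p) i.
Proof.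
elim: n => [|n IH].
  rewrite big_ord0 /killed_step; case: ifP => // _; apply: big1 => m _.
  by rewrite big_ord0 mulr0.
rewrite big_ord_recr/= -IH -killed_stepD; congr (Q _ i).
by apply/funext => m; rewrite big_ord_recr.
Qed.

Lemma norm_killed_step_le f g :
  (forall i, E i -> `|f i| <= g i) -> forall i, E i -> `|Q f i| <= Q g i.
Proof.
move=> fg i Ei; rewrite /killed_step; case: ifP => _; first by rewrite normr0.
apply: le_trans (ler_norm_sum _ _ _) _; apply: ler_sum => m _.
have [Em|Em] := pselect (E m); last by rewrite (rate_closed lq)// !mul0r normr0.
have K0 : 0 <= q i m / (lam + exit_rate q i).
  by rewrite divr_ge0 ?(rate_ge0 lq)// addr_ge0// ltW// (exit_rate_gt0 lq).
by rewrite normrM (ger0_norm K0) ler_wpM2l// fg.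
Qed.

Lemma norm_iter_killed_step_le (u : nat -> R) M n :
  (forall i, E i -> `|u i| <= M) ->
  forall i, E i -> `|iter n Q u i| <= M * iter n Q (fun=> 1) i.
Proof.
move=> uM; elim: n => [|n IH] i Ei /=; first by rewrite mulr1 uM.
by rewrite -killed_stepZ; exact: norm_killed_step_le.
Qed.

(** Since Q vanishes at k, the equations off k are the single identity u = u_k 1_k + Q u at all
    states; it is unrolled n times. *)
Lemma killed_step_expansion (u : nat -> R) n :
  (forall i, E i -> i <> k -> u i = Q u i) ->
  forall i, E i ->
  u i = u k * (\sum_(p < n) iter p Q (fun m => (m == k)%:R) i) + iter n Q u i.
Proof.
move=> uQ.
have uE i : E i -> u i = u k * (i == k)%:R + Q u i.
  move=> Ei; case: eqP => [->|ik]; last by rewrite mulr0 add0r uQ.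
  by rewrite /killed_step eqxx mulr1 addr0.
elim: n => [|n IH] i Ei; first by rewrite big_ord0 mulr0 add0r.
rewrite uE// (eq_killed_step IH Ei) killed_stepD killed_stepZ killed_step_sum.
by rewrite big_ord_recl/= mulrDr addrA.
Qed.

(** In the expansion the remainder Q^n u is dominated by M Q^n 1, so only the Neumann series of the
    indicator of k survives in the limit. *)
Lemma killed_step_unique (u : nat -> R) M (L : R) j :
  (forall i, E i -> `|u i| <= M) -> (forall i, E i -> i <> k -> u i = Q u i) ->
  E j ->
  (fun n => \sum_(p < n) iter p Q (fun m => (m == k)%:R) j) @ \oo --> L ->
  (fun n => iter n Q (fun=> 1) j) @ \oo --> (0 : R) ->
  u j = u k * L.
Proof.
move=> uM uQ Ej cL c0.
have cu : iter n Q u j @[n --> \oo] --> (0 : R).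
  apply/norm_cvg0P.
  apply: (@squeeze_cvgr _ _ _ _ (fun=> 0) (fun n => M * iter n Q (fun=> 1) j)).
  - by apply: nearW => n; rewrite normr_ge0/= norm_iter_killed_step_le.
  - exact: cvg_cst.
  - by rewrite -[X in _ --> X](mulr0 M); apply: cvgMr.
have : (fun=> u j) @ \oo --> u k * L + 0.
  rewrite (_ : (fun=> _) = (fun n => u k * (\sum_(p < n) iter p Q (fun m => (m == k)%:R) j)
     + iter n Q u j)); last by apply/funext => n; exact: killed_step_expansion.
  by apply: cvgD => //; apply: cvgMr.
rewrite addr0 => /(cvg_unique _ (cvg_cst (u j))); exact.
Qed.

End killed_step_algebra.

(** * Laplace transform of a hitting time *)

Section laplace_hitting.
Context (R : realType) (E : set nat) (q : nat -> nat -> R).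
Context d (Omega : measurableType d) (P : nat -> probability Omega R).
Variables (Y : nat -> Omega -> nat) (H : nat -> Omega -> R).
Hypothesis lq : local_rates E q.
Hypothesis mY : forall n, measurable_fun setT (Y n).
Hypothesis mH : forall n, measurable_fun setT (H n).
Hypothesis YE : forall n w, E (Y n w).
Hypothesis H_gt0 : forall n w, 0 < H n w.
Hypothesis law : has_jump_law E q P Y H.
Variable k : nat.

Lemma measurable_hit_time : measurable_fun setT (hit_time Y H k).
Proof.
apply: (@measurable_fun_fiber _ _ _ _ (hit_index Y k) (jump_time H)).
  exact: measurable_hit_index.
by move=> n; exact: measurable_jump_time.
Qed.

Definition hit_laplace (j : nat) (lam : R) : R :=
  \int[P j]_(w in hit_event Y k) expR (- lam * hit_time Y H k w).

Lemma measurable_exp_hit_time lam D :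
  measurable_fun D (fun w => expR (- lam * hit_time Y H k w)).
Proof.
apply: measurable_funTS; apply: measurableT_comp => //.
by apply: measurable_funM => //; exact: measurable_hit_time.
Qed.

Lemma hit_laplaceE j lam : 0 <= lam ->
  (\int[P j]_(w in hit_event Y k) (expR (- lam * hit_time Y H k w))%:E =
   (hit_laplace j lam)%:E)%E.
Proof.
move=> lam0; rewrite /hit_laplace /Rintegral fineK// ge0_fin_numE; last first.
  by apply: integral_ge0 => w _; rewrite lee_fin expR_ge0.
apply: (@le_lt_trans _ _ (\int[P j]_(w in hit_event Y k) (cst 1 w))%E).
  apply: ge0_le_integral => //.
  - exact: measurable_hit_event.
  - by apply/measurable_EFinP; exact: measurable_exp_hit_time.
  move=> w _; rewrite lee_fin -expR0 ler_expR mulNr oppr_le0 mulr_ge0//.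
  exact: hit_time_ge0.
rewrite integral_cst ?mul1e//; last exact: measurable_hit_event.
by rewrite (le_lt_trans (probability_le1 _ _))// ?ltry//; exact: measurable_hit_event.
Qed.

(** Decomposes [hit_event] by the index of the first hit; the event of a first hit at p is the
    indicator of k evaluated at [Y p] on [not_hit]. *)
Lemma hit_laplace_series j lam : E j -> 0 < lam ->
  (\sum_(0 <= p <oo) (iter p (killed_step q k lam) (fun m => (m == k)%:R) j)%:E =
   (hit_laplace j lam)%:E)%E.
Proof.
move=> Ej lam0; rewrite -hit_laplaceE ?ltW//.
rewrite (@ge0_integral_fiber _ _ _ (P j) (hit_index Y k))//.
- apply: eq_eseriesr => p _; rewrite -(integral_killed_step lq mY mH YE H_gt0 law)//.
  rewrite hit_event_index integral_mkcondr; apply: eq_integral => w; rewrite inE => nh.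
  rewrite patchE (_ : (w \in _) = (Y p w == k)); last first.
    by apply/idP/eqP; rewrite inE.
  case: eqP => Yp; last by rewrite mulr0.
  by rewrite mulr1 /hit_time (hit_indexE Yp nh).
- exact: measurable_hit_index.
- exact: measurable_hit_event.
- by apply/measurable_EFinP; exact: measurable_exp_hit_time.
Qed.

Lemma cvg_hit_laplace j lam : E j -> 0 < lam ->
  (fun n => \sum_(p < n) iter p (killed_step q k lam) (fun m => (m == k)%:R) j) @ \oo
    --> hit_laplace j lam.
Proof.
move=> Ej lam0.
have a0 p : (0 <= (iter p (killed_step q k lam) (fun m => (m == k)%:R) j)%:E)%E.
  by rewrite lee_fin; apply: (iter_killed_step_ge0 lq); rewrite ?ltW.
have := @is_cvg_nneseries _ _ xpredT 0%N (fun p _ _ => a0 p).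
move=> /cvgP; rewrite hit_laplace_series//.
under eq_fun do rewrite sumEFin big_mkord.
by move/fine_cvg.
Qed.

Lemma hit_laplace_ge0 j lam : 0 <= hit_laplace j lam.
Proof. by apply: Rintegral_ge0 => w _; exact: expR_ge0. Qed.

Lemma hit_laplace_le1 j lam : 0 <= lam -> hit_laplace j lam <= 1.
Proof.
move=> lam0; rewrite -lee_fin -hit_laplaceE//.
apply: (@le_trans _ _ (\int[P j]_(w in hit_event Y k) (cst 1 w))%E).
  apply: ge0_le_integral => //.
  - exact: measurable_hit_event.
  - by apply/measurable_EFinP; exact: measurable_exp_hit_time.
  move=> w _; rewrite lee_fin -expR0 ler_expR mulNr oppr_le0 mulr_ge0//.
  exact: hit_time_ge0.
by rewrite integral_cst ?mul1e ?probability_le1//; exact: measurable_hit_event.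
Qed.

Lemma hit_laplace_self lam : E k -> 0 < lam -> hit_laplace k lam = 1.
Proof.
move=> Ek lam0; have := cvg_hit_laplace Ek lam0.
move=> /(@cvg_unique _ (@Rhausdorff R)); apply; apply: cvg_near_cst; near=> n.
have n0 : (0 < n)%N by near: n; exact: nbhs_infty_gt.
rewrite -(prednK n0) big_ord_recl/= eqxx big1 ?addr0// => p _.
by rewrite /killed_step eqxx.
Unshelve. all: by end_near. Qed.

(** For j != k the partial sums satisfy a_{n+1}(j) = (Q a_n)(j), and Q, being a finite sum at each
    state, commutes with the limit. *)
Lemma hit_laplace_first_step j lam : E j -> 0 < lam -> j <> k ->
  hit_laplace j lam = killed_step q k lam (hit_laplace ^~ lam) j.
Proof.
move=> Ej lam0 jk.
have jkF : (j == k) = false by apply/eqP.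
set a := fun n i => \sum_(p < n) iter p (killed_step q k lam) (fun m => (m == k)%:R) i.
have aS n : a n.+1 j = killed_step q k lam (a n) j.
  by rewrite killed_step_sum /a big_ord_recl/= jkF add0r.
have c1 := cvg_hit_laplace Ej lam0.
have c2 : (fun n => killed_step q k lam (a n) j) @ \oo --> hit_laplace j lam.
  rewrite (_ : (fun n => _) = (fun n => a n.+1 j)); last by apply/funext => n; rewrite aS.
  by rewrite (cvg_shiftS (fun n => a n j)).
apply: (cvg_unique (@Rhausdorff R) c2); rewrite /= /killed_step jkF.
apply: cvg_big => [|m _]; first exact: add_continuous.
have [Em|Em] := pselect (E m).
  by apply: cvgMr; exact: cvg_hit_laplace.
by under eq_fun do rewrite (rate_closed lq)// !mul0r; rewrite (rate_closed lq)// !mul0r; exact: cvg_cst.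
Qed.

End laplace_hitting.

(** * Birth-death rates with and without catastrophes *)

Section non_explosion.
Context (R : realType) (E : set nat) (q : nat -> nat -> R).
Context d (Omega : measurableType d) (P : nat -> probability Omega R).
Variables (Y : nat -> Omega -> nat) (H : nat -> Omega -> R).
Variable X : R -> Omega -> option nat.
Hypothesis lq : local_rates E q.
Hypothesis mY : forall n, measurable_fun setT (Y n).
Hypothesis mH : forall n, measurable_fun setT (H n).
Hypothesis YE : forall n w, E (Y n w).
Hypothesis H_gt0 : forall n w, 0 < H n w.
Hypothesis pathX : is_jump_path Y H X.
Hypothesis law : has_jump_law E q P Y H.

Lemma measurable_jump_time_le n (t : R) : measurable [set w | jump_time H n w <= t].
Proof.
rewrite -[X in measurable X]setTI -preimage_itvNyc.
exact: measurable_jump_time.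
Qed.

Lemma measurable_state (t : R) n : 0 <= t -> measurable [set w | X t w = Some n].
Proof.
move=> t0.
rewrite (_ : [set w | _] = \bigcup_m ([set w | jump_time H m w <= t] `&`
   ~` [set w | jump_time H m.+1 w <= t] `&` [set w | Y m w = n])).
  apply: bigcup_measurable => m _; apply: measurableI; last exact: measurable_fiber.
  apply: measurableI; first exact: measurable_jump_time_le.
  by apply: measurableC; exact: measurable_jump_time_le.
apply/seteqP; split => w /=.
  move=> /(jump_path_Some pathX t0)[m /andP[h1 h2] Ym]; exists m => //=; split => //; split => //.
  by apply/negP; rewrite -ltNge.
move=> [m _ /= [[h1 /negP]]]; rewrite -ltNge => h2 Ym.
by rewrite -Ym; apply: pathX.1; rewrite h1.
Qed.

(** If all jump times are at most t, the path is in state [None] at t, which has probability 0 when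
    the states carry total mass 1. Continuity from above along the decreasing events finishes. *)
Lemma cvg_jump_time_le (j : nat) (t : R) : 0 <= t ->
  (\sum_(0 <= n <oo) P j [set w | X t w = Some n] = 1)%E ->
  (fun n => P j [set w | jump_time H n w <= t]) @ \oo --> 0%E.
Proof.
move=> t0 ne.
have : P j (\bigcap_n [set w | jump_time H n w <= t]) = 0%E.
  set A := \bigcup_n [set w | X t w = Some n].
  have mA : measurable A by apply: bigcup_measurable => n _; exact: measurable_state.
  have PA : P j A = 1%E.
    rewrite /A measure_bigcup//; last by move=> m n _ _ [w [/= -> []]].
    - by rewrite -ne; apply: eq_eseriesl => n; exact: mem_set.
    - by move=> n _; exact: measurable_state.
  apply/eqP; rewrite -measure_le0 -(subee (x := 1%E))// -{2}PA -probability_setC//.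
  apply: le_measure; rewrite ?inE.
  - by apply: bigcap_measurableType => n _; exact: measurable_jump_time_le.
  - exact: measurableC.
  - by move=> w /= h [n _ /=]; rewrite pathX.2// => m; exact: h.
move=> <-; apply: nonincreasing_cvg_mu.
- by rewrite (le_lt_trans (probability_le1 _ _)) ?ltry//; exact: measurable_jump_time_le.
- by move=> n; exact: measurable_jump_time_le.
- by apply: bigcap_measurableType => n _; exact: measurable_jump_time_le.
- move=> m n mn; apply/subsetPset => w /=; apply: le_trans.
  exact: jump_time_le.
Qed.

(** Q^n 1 is the expectation of exp(-lam J_n) on paths avoiding k, hence at most P(J_n <= t) +
    exp(-lam t) for every t >= 0. First t is taken large, then n. *)
Lemma non_explosive_killed_step (j k : nat) (lam : R) : E j -> 0 < lam ->
  (forall t, 0 <= t -> (\sum_(0 <= n <oo) P j [set w | X t w = Some n] = 1)%E) ->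
  (fun n => iter n (killed_step q k lam) (fun=> 1) j) @ \oo --> (0 : R).
Proof.
move=> Ej lam0 ne.
have it0 n : 0 <= iter n (killed_step q k lam) (fun=> 1) j.
  by apply: (iter_killed_step_ge0 lq); rewrite ?ltW.
have itle n t : 0 <= t -> iter n (killed_step q k lam) (fun=> 1) j <=
    fine (P j [set w | jump_time H n w <= t]) + expR (- lam * t).
  move=> t0; set D := [set w | _].
  have mD : measurable D by exact: measurable_jump_time_le.
  rewrite -lee_fin EFinD fineK ?fin_num_measure//.
  rewrite -(integral_killed_step lq mY mH YE H_gt0 law)//.
  have mexp A : measurable_fun A (fun w => (expR (- lam * jump_time H n w))%:E).
    apply/measurable_EFinP; apply: measurable_funTS; apply: measurableT_comp => //.
    by apply: measurable_funM => //; exact: measurable_jump_time.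
  under eq_integral do rewrite mulr1.
  apply: (@le_trans _ _ (\int[P j]_w (expR (- lam * jump_time H n w))%:E)%E).
    by apply: ge0_subset_integral => //; exact: measurable_not_hit.
  apply: (@le_trans _ _ (\int[P j]_w ((\1_D w)%:E + (expR (- lam * t))%:E))%E).
    apply: ge0_le_integral => //.
      by apply: emeasurable_funD => //; apply/measurable_EFinP; exact: measurable_indic.
    move=> w _; rewrite -EFinD lee_fin indicE; case: (boolP (w \in D)) => wD.
      rewrite ler_wpDr ?expR_ge0// -expR0 ler_expR mulNr oppr_le0 mulr_ge0 ?(ltW lam0)//.
      exact: jump_time_ge0.
    rewrite add0r ler_expR !mulNr lerN2 ler_wpM2l ?(ltW lam0)// leNgt; apply/negP => h.
    by move/negP : wD; apply; apply/mem_set; exact: ltW.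
  rewrite ge0_integralD//; last first.
    by apply/measurable_EFinP; exact: measurable_indic.
  rewrite integral_indic// setIT leeD2l// integral_cst//.
  by rewrite [X in (_ * X)%E](probability_setT (P j)) mule1.
apply/cvgrPdist_le => e e0.
have [t t0 te] : exists2 t, 0 <= t & expR (- lam * t) <= e / 2.
  have e2 : 0 < e / 2 by rewrite divr_gt0.
  exists (Num.max 0 (- ln (e / 2) / lam)); first by rewrite le_max lexx.
  rewrite -[leRHS]lnK ?posrE// ler_expR mulNr lerNl.
  apply: (@le_trans _ _ (lam * (- ln (e / 2) / lam))); first by rewrite mulrCA divff ?mulr1 ?gt_eqF.
  by rewrite ler_wpM2l ?(ltW lam0)// le_max lexx orbT.
have /fine_cvg/cvgrPdist_le/(_ (e / 2)) := cvg_jump_time_le t0 (ne t t0).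
rewrite divr_gt0// => /(_ isT); apply: filterS => n /=; rewrite !sub0r !normrN => h.
rewrite ger0_norm// (le_trans (itle n t t0))// (splitr e) lerD//.
by rewrite (le_trans _ h)// ler_norm.
Qed.

End non_explosion.

(** * First-step equations with and without catastrophes *)

Section catastrophes.
Context (R : realType) (r : nat) (alpha beta : nat -> R).
Hypothesis alpha_gt0 : forall n, (r <= n)%N -> 0 < alpha n.
Hypothesis beta_ge0 : forall n, (r.+1 <= n)%N -> 0 <= beta n.
Local Notation E := [set n | (r <= n)%N].
Local Notation q := (bd_rate r alpha beta).

Lemma local_bd_rate : local_rates E q.
Proof.
split => /= [i m|i|i m|i m|i|i] ri; rewrite /bd_rate.
- case: eqP => _; first by rewrite ltW// alpha_gt0.
  by case: ifP => // /andP[? _]; exact: beta_ge0.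
- rewrite (_ : (i == i.+1) = false); last by lia.
  by rewrite (_ : _ && _ = false)//; lia.
- move=> im; rewrite (_ : (m == i.+1) = false); last by lia.
  by rewrite (_ : _ && _ = false)//; lia.
- move=> rm; rewrite (_ : (m == i.+1) = false); last by lia.
  by rewrite (_ : _ && _ = false)//; lia.
- by rewrite eqxx alpha_gt0.
- by lia.
Qed.

Variable xi : R.
Hypothesis xi_gt0 : 0 < xi.
Local Notation qc := (bd_catastrophe_rate r alpha beta xi).

(** At r+1 death and catastrophe lead to the same state and their rates add up, so one additive
    correction covers all states above r. *)
Lemma bd_catastrophe_rateE i m : E i ->
  qc i m = q i m + (if (r < i)%N && (m == r) then xi else 0).
Proof.
rewrite /= /bd_catastrophe_rate /bd_rate => ri.
have [->|mi] := eqVneq m i.+1.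
  by rewrite (_ : (i.+1 == r) = false) ?andbF ?addr0//; lia.
have [->|ir] := eqVneq i r.+1.
  by rewrite ltnSn /=; case: eqP => // _; rewrite addr0.
have [ir2|ir2] := leqP r.+2 i.
  have -> : (r < i)%N = true by lia.
  rewrite /=; case: eqP => [->|_].
    by rewrite (_ : (i.-1 == r) = false) ?addr0//; lia.
  by rewrite add0r.
by rewrite (_ : (r < i)%N = false) /= ?addr0//; lia.
Qed.

Lemma local_bd_catastrophe_rate : local_rates E qc.
Proof.
have lq := local_bd_rate.
split => /= [i m|i|i m|i m|i|i] ri; rewrite ?bd_catastrophe_rateE//.
- by rewrite addr_ge0 ?(rate_ge0 lq)//; case: ifP => // _; exact: ltW.
- by rewrite (rate_diag lq)// add0r; case: ifP => // ?; lia.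
- by move=> im; rewrite (rate_far lq)// add0r; case: ifP => // ?; lia.
- by move=> rm; rewrite (rate_closed lq)// add0r; case: ifP => // ?; lia.
- by rewrite ltr_pwDl ?(rate_up_gt0 lq)//; case: ifP => // _; exact: ltW.
- by lia.
Qed.

Lemma bd_catastrophe_sum i (f : nat -> R) : E i ->
  \sum_(m < i.+2) qc i m * f m = \sum_(m < i.+2) q i m * f m + (if (r < i)%N then xi * f r else 0).
Proof.
move=> Ei; under eq_bigr do rewrite bd_catastrophe_rateE// mulrDl.
rewrite big_split/=; congr (_ + _); case: ifPn => ri /=; last first.
  by apply: big1 => m _; rewrite mul0r.
have r2 : (r < i.+2)%N by lia.
rewrite (bigD1 (Ordinal r2))//= eqxx big1 ?addr0// => m /eqP mr.
by case: eqP => [mr'|_]; [exfalso; apply: mr; apply: val_inj|rewrite mul0r].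
Qed.

Lemma bd_catastrophe_exit_rate i : E i ->
  exit_rate qc i = exit_rate q i + (if (r < i)%N then xi else 0).
Proof.
move=> Ei; rewrite (exit_rateE local_bd_catastrophe_rate)// (exit_rateE local_bd_rate)//.
have := @bd_catastrophe_sum i (fun=> 1) Ei.
by under eq_bigr do rewrite mulr1; under [in RHS]eq_bigr do rewrite mulr1; rewrite mulr1.
Qed.

Lemma killed_stepE (p : nat -> nat -> R) (k i : nat) (lam : R) f : i <> k ->
  killed_step p k lam f i = (\sum_(m < i.+2) p i m * f m) / (lam + exit_rate p i).
Proof.
move=> /eqP/negbTE ik; rewrite /killed_step ik mulr_suml.
by apply: eq_bigr => m _; rewrite mulrAC.
Qed.

(* Subtracting the constant xi phi_r / (lam + xi) turns the equations at lam   *)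
(* of the chain with catastrophes into those at lam + xi of the chain without. *)
Lemma catastrophe_shift (phi : nat -> R) (k : nat) (lam : R) : 0 < lam ->
  (forall i, E i -> i <> k -> phi i = killed_step qc k lam phi i) ->
  let u i := (lam + xi) * phi i - xi * phi r in
  forall i, E i -> i <> k -> u i = killed_step q k (lam + xi) u i.
Proof.
move=> lam0 hphi u i Ei ik.
have ex0 : 0 < exit_rate q i by exact: exit_rate_gt0 local_bd_rate _ Ei.
have mu0 : 0 < lam + xi + exit_rate q i by rewrite !addr_gt0.
(* With denominators cleared, one equation holds at all states: above r a catastrophe adds xi to the
   exit rate and xi phi_r to the sum, and at i = r the two added terms are equal. *)
have hc : (lam + exit_rate q i + xi) * phi i = \sum_(m < i.+2) q i m * phi m + xi * phi r.
  have := hphi i Ei ik; rewrite killed_stepE//.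
  have lc0 : lam + exit_rate qc i != 0.
    by rewrite gt_eqF// addr_gt0// (exit_rate_gt0 local_bd_catastrophe_rate).
  move=> h; have {h} : phi i * (lam + exit_rate qc i) = \sum_(m < i.+2) qc i m * phi m.
    by rewrite {1}h divfK.
  rewrite bd_catastrophe_sum// bd_catastrophe_exit_rate//.
  case: ifPn => ri h; first by rewrite -h; ring.
  have -> : i = r by move: Ei => /=; lia.
  have ir : i = r by move: Ei => /=; lia.
  by move: h; rewrite ir !addr0 => <-; ring.
have mu0' : lam + xi + exit_rate q i != 0 by rewrite gt_eqF.
rewrite killed_stepE// /u; apply: (mulIf mu0'); rewrite divfK//.
under eq_bigr do rewrite mulrBr.
rewrite sumrB.
under eq_bigr do rewrite mulrCA.
rewrite -mulr_sumr -mulr_suml -(exit_rateE local_bd_rate)//.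
have -> : \sum_(m < i.+2) q i m * phi m = (lam + exit_rate q i + xi) * phi i - xi * phi r.
  by rewrite hc addrK.
by ring.
Qed.

End catastrophes.

(** * Moments from Laplace transforms *)

Section monotone_approximation.
Context d (T : measurableType d) (R : realType) (mu : {measure set T -> \bar R}).

(** Fatou bounds the integral of g above by the limit, and f_n <= g bounds it below; the
    integrability of g is a conclusion. *)
Lemma ge0_integral_cvg_le (f : nat -> T -> \bar R) (g : T -> \bar R) (a : nat -> R) (l : R) :
  (forall n, measurable_fun setT (f n)) -> measurable_fun setT g ->
  (forall n w, 0 <= f n w)%E -> (forall n w, f n w <= g w)%E ->
  (forall w, f ^~ w @ \oo --> g w) ->
  (forall n, \int[mu]_w f n w = (a n)%:E)%E -> a @ \oo --> l ->
  (\int[mu]_w g w = l%:E)%E.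
Proof.
move=> mf mg f0 fg fcvg fa al.
have ea : (fun n => (a n)%:E) @ \oo --> l%:E by apply: cvg_EFin => //; exact: nearW.
apply/eqP; rewrite eq_le; apply/andP; split.
  have := @fatou _ _ _ mu setT measurableT f mf (fun n w _ => f0 n w).
  rewrite (eq_integral g); last by move=> w _; rewrite (cvg_limn_einf_sup (fcvg w)).1.
  move=> /le_trans; apply; rewrite (_ : (fun n => _) = (fun n => (a n)%:E)); last exact/funext.
  by rewrite (cvg_limn_einf_sup ea).1.
apply: (cvge_to_le ea); apply: nearW => n; rewrite -fa.
by apply: ge0_le_integral.
Qed.

End monotone_approximation.

Section laplace_moments.
Context d (T : measurableType d) (R : realType) (P : probability T R).
Variables (A : set T) (S : T -> R).
Hypothesis mA : measurable A.
Hypothesis mS : measurable_fun setT S.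
Hypothesis S0 : forall w, 0 <= S w.

Let tau w : \bar R := if w \in A then (S w)%:E else +oo%E.
(** [e lam] is exp(-lam tau), with value 0 where tau is infinite, and [g lam] is the difference
    quotient that approximates tau from below. *)
Let e (lam : R) w : R := if w \in A then expR (- lam * S w) else 0.
Let g (lam : R) w : R := (1 - e lam w) / lam.

Lemma measurable_extended_time : measurable_fun setT tau.
Proof.
apply: measurable_fun_ifT => //.
- by apply: (measurable_fun_bool true); rewrite setTI (_ : _ @^-1` _ = A)//;
   apply/seteqP; split => w /=; [exact: set_mem|exact: mem_set].
- exact/measurable_EFinP.
Qed.

Let me lam : measurable_fun setT (e lam).
Proof.
rewrite (_ : e lam = \1_A \* (fun w => expR (- lam * S w))).
  by apply: measurable_funM; [exact: measurable_indic|apply: measurableT_comp => //; exact: measurable_funM].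
by apply/funext => w; rewrite /e /= indicE; case: ifP => _; rewrite ?mul1r ?mul0r.
Qed.

Let e01 (lam : R) w : 0 <= lam -> 0 <= e lam w <= 1.
Proof.
move=> lam0; rewrite /e; case: ifP => _; last by rewrite lexx ler01.
by rewrite expR_ge0/= -expR0 ler_expR mulNr oppr_le0 mulr_ge0.
Qed.

Let mg lam : measurable_fun setT (g lam).
Proof. by apply: measurable_funM => //; exact: measurable_funB. Qed.

Let g_ge0 (lam : R) w : 0 < lam -> 0 <= g lam w.
Proof.
move=> lam0; have /andP[_ e1] := e01 w (ltW lam0).
by rewrite divr_ge0 ?(ltW lam0)// subr_ge0.
Qed.

Let g_le (lam : R) w : 0 < lam -> ((g lam w)%:E <= tau w)%E.
Proof.
move=> lam0; rewrite /tau /g /e; case: ifP => _; last by rewrite leey.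
rewrite lee_fin ler_pdivrMr// lerBlDr -lerBlDl.
by apply: le_trans (expR_ge1Dx _); rewrite mulNr mulrC.
Qed.

Let lam_ (n : nat) : R := n.+1%:R^-1.
Let lam_gt0 n : 0 < lam_ n. Proof. by rewrite invr_gt0. Qed.

(** With y = lam x, this is exp(-y) <= 1 / (1 + y) <= 1 - y + y^2, the last inequality amounting to
    y^3 >= 0. It is the lower bound of the squeeze in [g_cvg]. *)
Let g_ge (lam x : R) : 0 < lam -> 0 <= x -> x - lam * x ^+ 2 <= (1 - expR (- lam * x)) / lam.
Proof.
move=> lam0 x0; have y0 : 0 <= lam * x by rewrite mulr_ge0// ltW.
rewrite ler_pdivlMr// lerBrDl.
have y1 : 0 < 1 + lam * x by rewrite ltr_pwDl.
have h : expR (- lam * x) <= (1 + lam * x)^-1.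
  by rewrite mulNr expRN lef_pV2 ?posrE ?expR_gt0// expR_ge1Dx.
have h2 : (1 + lam * x)^-1 + (x - lam * x ^+ 2) * lam <= 1.
  rewrite -(ler_pM2r y1) mulrDl mulVf ?gt_eqF// mul1r.
  have : 0 <= (lam * x) ^+ 3 by rewrite exprn_ge0.
  by nra.
by rewrite (le_trans _ h2)// lerD2r.
Qed.

Let g_cvg w : (fun n => (g (lam_ n) w)%:E) @ \oo --> tau w.
Proof.
rewrite /tau /g /e; case: ifP => _.
  apply: cvg_EFin; first exact: nearW.
  apply: (@squeeze_cvgr _ _ _ _ (fun n => S w - lam_ n * S w ^+ 2) (fun=> S w)).
  - apply: nearW => n; rewrite g_ge//=.
    rewrite ler_pdivrMr// lerBlDr -lerBlDl.
    by apply: le_trans (expR_ge1Dx _); rewrite mulNr mulrC.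
  - rewrite -[X in _ --> X]subr0 -(mul0r (S w ^+ 2)).
    by apply: cvgB; [exact: cvg_cst|apply: cvgMl; exact: cvg_harmonic].
  - exact: cvg_cst.
(* Where tau is infinite, the quotient is 1 / lam_n = n + 1. *)
under eq_fun do rewrite subr0 mul1r invrK.
apply/cvgeryP/cvgryPge => M; near=> n.
by apply: (@le_trans _ _ n%:R); [near: n; exact: nbhs_infty_ger|rewrite ler_nat].
Unshelve. all: by end_near. Qed.

Variables (phi : R -> R) (rho : R -> R) (rho' : R).
Hypothesis phiE : forall lam : R, 0 < lam ->
  (\int[P]_(w in A) (expR (- lam * S w))%:E = (phi lam)%:E)%E.
Hypothesis phi_rho : forall lam : R, 0 < lam -> 1 - phi lam = lam * rho lam.
Hypothesis drho : is_derive (0 : R) (1 : R) rho rho'.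

Let int_e (lam : R) : 0 < lam -> (\int[P]_w (e lam w)%:E = (phi lam)%:E)%E.
Proof.
move=> lam0; rewrite -phiE// [RHS]integral_mkcond; apply: eq_integral => w _.
by rewrite patchE /e; case: ifP.
Qed.

Let le0 (lam : R) : 0 < lam -> 0 <= lam. Proof. exact: ltW. Qed.

Let int_g (lam : R) : 0 < lam -> (\int[P]_w (g lam w)%:E = (rho lam)%:E)%E.
Proof.
move=> lam0.
have int_e' : (\int[P]_w (1 - e lam w)%:E + (phi lam)%:E = 1)%E.
  rewrite -int_e// -ge0_integralD//.
  - rewrite (eq_integral (cst 1%E)); last by move=> w _; rewrite -EFinD subrK.
    by rewrite integral_cst// mul1e; exact: probability_setT.
  - by move=> w _; have /andP[_ ?] := e01 w (le0 lam0); rewrite lee_fin subr_ge0.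
  - by apply/measurable_EFinP; exact: measurable_funB.
  - by move=> w _; have /andP[? _] := e01 w (le0 lam0); rewrite lee_fin.
  - by apply/measurable_EFinP.
have {}int_e' : (\int[P]_w (1 - e lam w)%:E = (1 - phi lam)%:E)%E.
  by rewrite EFinB -int_e' addeK.
under eq_integral do rewrite /g mulrC EFinM.
rewrite ge0_integralZl//.
- by rewrite int_e' phi_rho// -EFinM mulKf// gt_eqF.
- by apply/measurable_EFinP; exact: measurable_funB.
- by move=> w _; have /andP[_ ?] := e01 w (le0 lam0); rewrite lee_fin subr_ge0.
- by rewrite lee_fin invr_ge0 ltW.
Qed.

(** Squaring the exponential doubles lam, so the integral is (1 - 2 phi(lam) + phi(2 lam)) / lam^2,
    and phi = 1 - lam rho is substituted. *)
Let int_g2 (lam : R) : 0 < lam ->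
  (\int[P]_w (g lam w ^+ 2)%:E = (2 * (rho lam - rho (2 * lam)) / lam)%:E)%E.
Proof.
move=> lam0; have lam20 : 0 < 2 * lam by rewrite mulr_gt0.
have lamn0 : lam != 0 by rewrite gt_eqF.
have e2 w : e (2 * lam) w = e lam w ^+ 2.
  rewrite /e; case: ifP => _; last by rewrite expr0n.
  by rewrite -expRM_natl; congr expR; ring.
have g0 w : (0 <= (g lam w ^+ 2)%:E)%E by rewrite lee_fin sqr_ge0.
have mg2 : measurable_fun setT (fun w => (g lam w ^+ 2)%:E).
  by apply/measurable_EFinP; apply: measurable_funX.
(* The term with a minus sign is kept on the left so that additivity for nonnegative functions
   applies. *)
have : (\int[P]_w (g lam w ^+ 2)%:E + \int[P]_w ((2 * lam^-1 ^+ 2)%:E * (e lam w)%:E)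
   = \int[P]_w ((lam^-1 ^+ 2)%:E + (lam^-1 ^+ 2)%:E * (e (2 * lam) w)%:E))%E.
  rewrite -ge0_integralD//.
  - apply: eq_integral => w _; rewrite -!EFinM -!EFinD e2; congr EFin; rewrite /g; field.
    exact: lamn0.
  - move=> w _; have /andP[? _] := e01 w (le0 lam0).
    by rewrite -EFinM lee_fin !mulr_ge0// ?invr_ge0 ?(ltW lam0).
  - by apply: emeasurable_funM => //; apply/measurable_EFinP.
rewrite ge0_integralZl//; first last.
- by rewrite lee_fin mulr_ge0// exprn_ge0// invr_ge0 ltW.
- by move=> w _; have /andP[? _] := e01 w (le0 lam0); rewrite lee_fin.
- by apply/measurable_EFinP.
rewrite ge0_integralD//; first last.
- by apply: emeasurable_funM => //; apply/measurable_EFinP.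
- move=> w _; have /andP[? _] := e01 w (le0 lam20).
  by rewrite -EFinM lee_fin !mulr_ge0// ?invr_ge0 ?(ltW lam0).
- by move=> w _; rewrite lee_fin exprn_ge0// invr_ge0 ltW.
rewrite ge0_integralZl//; first last.
- by rewrite lee_fin exprn_ge0// invr_ge0 ltW.
- by move=> w _; have /andP[? _] := e01 w (le0 lam20); rewrite lee_fin.
- by apply/measurable_EFinP.
rewrite !int_e// integral_cst// [X in (_ * X + _)%E](probability_setT P) mule1.
rewrite -!EFinM -EFinD => h.
rewrite -[LHS](@addeK _ (2 * lam^-1 ^+ 2 * phi lam)%:E)// h -EFinB; congr EFin.
have -> : phi lam = 1 - lam * rho lam by rewrite -phi_rho//; ring.
have -> : phi (2 * lam) = 1 - 2 * lam * rho (2 * lam) by rewrite -phi_rho//; ring.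
by field.
Qed.

Let rho_cvg : rho x @[x --> (0 : R)] --> rho 0.
Proof.
by apply: differentiable_continuous; apply/derivable1_diffP; case: drho.
Qed.

Let lam_cvg : lam_ @ \oo --> (0 : R).
Proof. exact: cvg_harmonic. Qed.

Let drho_cvg (c : R) : 0 < c ->
  (rho (c * lam_ n) - rho 0) / lam_ n @[n --> \oo] --> c * rho'.
Proof.
move=> c0.
have [dr dE] := drho.
have : h^-1 *: (rho (h + 0) - rho 0) @[h --> (0 : R)^'] --> rho'.
  move: dr; rewrite /derivable => /cvg_ex[l hl].
  have <- : l = rho'.
    by rewrite -dE /derive; apply/esym/cvg_lim.
  by move: hl; under eq_fun do rewrite scaler1.
move=> /cvgr_dnbhsP/(_ (fun n => c * lam_ n)).
have cl : (forall n, c * lam_ n != 0) /\ c * lam_ n @[n --> \oo] --> (0 : R).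
  split => [n|]; first by rewrite mulf_neq0 ?gt_eqF.
  by rewrite -(mulr0 c); apply: cvgMr.
move=> /(_ cl) h.
rewrite (_ : (fun n => _) = (fun n => c * ((c * lam_ n)^-1 *: (rho (c * lam_ n + 0) - rho 0)))).
  by apply: cvgMr.
apply/funext => n; rewrite addr0 /GRing.scale/=; field.
by rewrite !gt_eqF.
Qed.

Lemma laplace_mean : (\int[P]_w tau w = (rho 0)%:E)%E.
Proof.
apply: (@ge0_integral_cvg_le _ _ _ P (fun n w => (g (lam_ n) w)%:E) tau (fun n => rho (lam_ n))).
- by move=> n; exact/measurable_EFinP.
- exact: measurable_extended_time.
- by move=> n w; rewrite lee_fin g_ge0.
- by move=> n w; exact: g_le.
- exact: g_cvg.
- by move=> n; exact: int_g.
- by apply: (cvg_comp lam_ rho lam_cvg).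
Qed.

(** The squared quotients have integrals 2 (rho(lam) - rho(2 lam)) / lam, which tend to 2 (rho' - 2
    rho') = -2 rho'. *)
Lemma laplace_second_moment : (\int[P]_w (tau w ^+ 2) = (- 2 * rho')%:E)%E.
Proof.
apply: (@ge0_integral_cvg_le _ _ _ P (fun n w => (g (lam_ n) w ^+ 2)%:E) (fun w => tau w ^+ 2)%E
   (fun n => 2 * (rho (lam_ n) - rho (2 * lam_ n)) / lam_ n)).
- by move=> n; apply/measurable_EFinP; exact: measurable_funX.
- by apply: emeasurable_funM; exact: measurable_extended_time.
- by move=> n w; rewrite lee_fin sqr_ge0.
- move=> n w; rewrite expe2 expr2 EFinM.
  by apply: lee_pmul => //; rewrite ?lee_fin ?g_ge0 ?g_le.
- move=> w; rewrite (_ : (fun n => _) = (fun n => (g (lam_ n) w)%:E * (g (lam_ n) w)%:E)%E); last first.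
    by apply/funext => n; rewrite -EFinM expr2.
  rewrite expe2; have := @g_cvg w; case: (tau w) (@g_le (lam_ 0) w (lam_gt0 0)) => [s _|_|h] c; last 1 first.
  + by move: h; rewrite leeNy_eq.
  + by apply: cvgeM.
  + by apply: cvgeM.
- by move=> n; exact: int_g2.
rewrite (_ : - 2 * rho' = 2 * (1 * rho' - 2 * rho')); last by ring.
rewrite (_ : (fun n => _) = (fun n => 2 * ((rho (1 * lam_ n) - rho 0) / lam_ n -
    (rho (2 * lam_ n) - rho 0) / lam_ n))).
  by apply: cvgMr; apply: cvgB; exact: drho_cvg.
by apply/funext => n; rewrite mul1r; field; rewrite gt_eqF.
Qed.

(** Integrates (tau - m)^2 + 2 m tau = tau^2 + m^2, an identity between nonnegative functions. *)
Lemma laplace_variance : 0 <= rho 0 ->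
  (\int[P]_w ((tau w - (rho 0)%:E) ^+ 2) = (- 2 * rho' - rho 0 ^+ 2)%:E)%E.
Proof.
move=> m0; set m := rho 0.
have mt := measurable_extended_time.
have t0 w : (0 <= tau w)%E by rewrite /tau; case: ifP => _; rewrite ?lee_fin ?leey.
have sq (x : \bar R) : (x ^+ 2 = x * x)%E by rewrite expe2.
have sq0 (x : \bar R) : (0 <= x ^+ 2)%E.
  by rewrite sq; case: x => [x| |]; rewrite ?lee_fin ?sqr_ge0 ?leey //= -expr2 sqr_ge0.
have mB : measurable_fun setT (fun w => (tau w - m%:E) ^+ 2)%E.
  by apply: emeasurable_funM; apply: emeasurable_funB.
have mt2 : measurable_fun setT (fun w => tau w ^+ 2)%E by apply: emeasurable_funM.
have : (\int[P]_w ((tau w - m%:E) ^+ 2) + \int[P]_w ((2 * m)%:E * tau w) =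
        \int[P]_w (tau w ^+ 2 + (m ^+ 2)%:E))%E.
  rewrite -ge0_integralD//.
  - apply: eq_integral => w _; rewrite /tau; case: ifP => _.
      by rewrite !sq -EFinB -!EFinM -!EFinD; congr EFin; ring.
    (* Where tau is infinite both sides are +oo; if m = 0 the product 2 m tau is 0 there. *)
    rewrite (_ : +oo - m%:E = +oo)%E// !sq /=; have [->|mn0] := eqVneq m 0; first by rewrite mulr0 mul0e.
    by rewrite [((2 * m)%:E * _)%E]gt0_muley ?gt0_muley// lte_fin mulr_gt0// lt_neqAle eq_sym mn0.
  - by move=> w _; rewrite mule_ge0// lee_fin mulr_ge0.
  - by apply: emeasurable_funM.
rewrite ge0_integralZl//; last by rewrite lee_fin mulr_ge0.
rewrite laplace_mean ge0_integralD//; last by move=> w _; rewrite lee_fin sqr_ge0.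
rewrite laplace_second_moment integral_cst//.
rewrite [X in ((m ^+ 2)%:E * X)%E](_ : _ = 1%E) ?mule1; last exact: probability_setT.
rewrite -EFinM -EFinD => h.
rewrite -[LHS](@addeK _ (2 * m * rho 0)%:E)// h -EFinB; congr EFin; rewrite -/m; ring.
Qed.

End laplace_moments.

(** * Independence of one holding time from the rest *)

Section independence.
Context (R : realType) (E : set nat) (q : nat -> nat -> R).
Context d (Omega : measurableType d) (P : nat -> probability Omega R).
Variables (Y : nat -> Omega -> nat) (H : nat -> Omega -> R).
Hypothesis lq : local_rates E q.
Hypothesis mY : forall n, measurable_fun setT (Y n).
Hypothesis mH : forall n, measurable_fun setT (H n).
Hypothesis YE : forall n w, E (Y n w).
Hypothesis H_gt0 : forall n w, 0 < H n w.
Hypothesis law : has_jump_law E q P Y H.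
Local Notation ex := (exit_rate q).

Variable a : nat.

(* A pi-system generating the sigma-algebra of all jumps and all holding times *)
(* but the a-th; each event constrains finitely many indices only.             *)
Definition cylinders_but : set (set Omega) := [set B |
  exists n (c : nat -> set nat) (s : nat -> R),
  [/\ forall m, 0 <= s m, forall m, (n < m)%N -> c m = setT,
      forall m, (n < m)%N -> s m = 0 &
      B = [set w | forall m, c m (Y m w) /\ (m != a -> s m < H m w)]]].

Lemma setI_closed_cylinders_but : setI_closed cylinders_but.
Proof.
move=> _ _ [n1 [c1 [s1 [s10 c1T s1T ->]]]] [n2 [c2 [s2 [s20 c2T s2T ->]]]].
exists (maxn n1 n2), (fun m => c1 m `&` c2 m), (fun m => Num.max (s1 m) (s2 m)); split.
- by move=> m; rewrite le_max s10.
- by move=> m; rewrite gtn_max => /andP[? ?]; rewrite c1T// c2T// setIT.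
- by move=> m; rewrite gtn_max => /andP[? ?]; rewrite s1T// s2T// maxxx.
apply/seteqP; split => w /=.
  move=> [h1 h2] m; have [c1m s1m] := h1 m; have [c2m s2m] := h2 m.
  by split => // ma; rewrite gt_max s1m// s2m.
move=> h; split => m; have [[? ?] hm] := h m; split => // ma;
  by have := hm ma; rewrite gt_max => /andP[].
Qed.

Lemma measurable_cylinders_but : cylinders_but `<=` measurable.
Proof.
move=> _ [n [c [s [_ _ _ ->]]]].
rewrite (_ : mkset _ = \bigcap_m (Y m @^-1` (c m)) `&`
   [set w | forall m, m != a -> s m < H m w]).
  apply: measurableI; last exact: (measurable_tails mH (fun m => m != a)).
  apply: bigcap_measurableType => m _; rewrite -[X in measurable X]setTI.
  exact: (mY _ measurableT).
apply/seteqP; split => w /=; first by move=> h; split => m; have [] := h m.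
by move=> [h1 h2] m; split; [exact: h1|exact: h2].
Qed.

Lemma cylinders_butT : cylinders_but setT.
Proof.
exists 0%N, (fun=> setT), (fun=> 0); split => //.
by apply/seteqP; split => // w _ m; split.
Qed.

Local Notation Sigma := (<<s cylinders_but >>).

(** On each path long enough to contain all constrained indices, both events are covered by
    [has_jump_law], and their weights differ only in the a-th factor. *)
Lemma independent_holding_time_cylinder j i B (t : R) :
  E j -> 0 <= t -> cylinders_but B ->
  (P j (B `&` ([set w | Y a w = i] `&` [set w | (t < H a w)%R])) =
   (expR (- ex i * t))%:E * P j (B `&` [set w | Y a w = i]))%E.
Proof.
move=> Ej t0 GB; have mB := measurable_cylinders_but GB.
have mYa : measurable [set w | Y a w = i] by exact: measurable_fiber.
have mHa : measurable [set w | t < H a w] by exact: measurable_tail.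
set D1 := B `&` _; set D2 := B `&` _.
have mD1 : measurable D1 by apply: measurableI => //; apply: measurableI.
have mD2 : measurable D2 by apply: measurableI.
have -> : P j D1 = (\int[P j]_(w in D1) (cst 1 w))%E by rewrite integral_cst// mul1e.
rewrite -(@integral_cst _ _ _ (P j) D2)//.
case: GB => n [c [s [s0 cT sT BE]]].
set N := maxn n.+1 a.+1.
have aN : (a < N)%N by rewrite leq_max leqnn orbT.
have nN : (n < N)%N by rewrite leq_max leqnn.
apply: (eq_integral_path mY (n := N)) => //; first by move=> w _; rewrite lee_fin.
move=> i'.
have [ok|nok] := pselect ([/\ forall m, (m <= N)%N -> E (i' m), forall m, (m <= N)%N -> c m (i' m) & i' a = i]); last first.
  have e w : D2 w -> path_event Y i' N w -> False.
    move=> [Bw Yi] pw; apply: nok; split.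
    - by move=> m mN; rewrite -(pw m mN).
    - by move=> m mN; rewrite -(pw m mN); move: Bw; rewrite BE => /(_ m)[].
    - by rewrite -(pw a (ltnW aN)).
  have -> : D1 `&` path_event Y i' N = set0.
    by apply/seteqP; split => // w [[Bw [Yi _]] pw]; apply: (e w).
  have -> : D2 `&` path_event Y i' N = set0.
    by apply/seteqP; split => // w [Dw pw]; exact: (e w).
  by rewrite !integral_set0.
have [Ei ci ia] := ok.
pose s' t' m := if m == a then t' else s m.
have DE t' : (B `&` ([set w | Y a w = i] `&` [set w | t' < H a w])) `&` path_event Y i' N =
    path_event Y i' N `&` [set w | forall m, (m < N)%N -> s' t' m < H m w].
  apply/seteqP; split => w /=.
    move=> [[Bw [Yi Ht]] pw]; split => // m mN; rewrite /s'; case: eqP => [->//|/eqP ma].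
    by move: Bw; rewrite BE => /(_ m)[_]; exact.
  move=> [pw h]; split => //; split; last first.
    split; first by rewrite pw ?(ltnW aN).
    by have := h a aN; rewrite /s' eqxx.
  rewrite BE => m; split.
    have [mN|Nm] := leqP m N; first by rewrite pw//; exact: ci.
    by rewrite cT// (ltn_trans nN).
  move=> ma; have [mN|Nm] := ltnP m N; first by have := h m mN; rewrite /s' (negbTE ma).
  by rewrite sT// (leq_trans nN).
(* Holding times are positive, so no constraint on the a-th one is the constraint at level 0. *)
have D2E : D2 = B `&` ([set w | Y a w = i] `&` [set w | 0 < H a w]).
  apply/seteqP; split => w [Bw]; last by move=> [].
  by move=> Yi; split => //; split => //=.
have mDt t' : measurable (path_event Y i' N `&` [set w | forall m, (m < N)%N -> s' t' m < H m w]).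
  apply: measurableI; first exact: measurable_path_event.
  exact: (measurable_tails mH (fun m => m < N)%N).
rewrite D2E !DE !integral_cst// mul1e.
have Pt t' : 0 <= t' -> P j (path_event Y i' N `&`
      [set w | forall m, (m < N)%N -> s' t' m < H m w]) = ((i' 0%N == j)%:R *
     \prod_(m < N) (q (i' m) (i' m.+1) / ex (i' m) * expR (- ex (i' m) * s' t' m)))%:E.
  by move=> t'0; apply: (jump_law_path lq law) => // m _; rewrite /s'; case: eqP.
rewrite [LHS](Pt t t0) [X in (_ * X)%E](Pt 0 (lexx 0)).
rewrite -EFinM; congr EFin; rewrite mulrCA; congr (_ * _); rewrite [RHS]mulrC.
apply: (@prodrM1 _ N a (fun m => q (i' m) (i' m.+1) / ex (i' m) * expR (- ex (i' m) * s' t m))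
  (fun m => q (i' m) (i' m.+1) / ex (i' m) * expR (- ex (i' m) * s' 0 m))) => //.
  by rewrite /s' eqxx mulr0 expR0 mulr1 ia.
by move=> m ma; rewrite /s' (negbTE ma).
Qed.

(** As functions of B both sides are finite measures; they agree on the pi-system of cylinders,
    hence on the sigma-algebra it generates. *)
Lemma independent_holding_time j i B (t : R) :
  E j -> 0 <= t -> Sigma B ->
  (P j (B `&` ([set w | Y a w = i] `&` [set w | (t < H a w)%R])) =
   (expR (- ex i * t))%:E * P j (B `&` [set w | Y a w = i]))%E.
Proof.
move=> Ej t0; have e0 : 0 <= expR (- ex i * t) by exact: expR_ge0.
have mYa : measurable [set w | Y a w = i] by exact: measurable_fiber.
have mHa : measurable [set w | t < H a w] by exact: measurable_tail.
have mD1 := measurableI _ _ mYa mHa.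
apply: (g_sigma_algebra_measure_unique cylinders_but measurable_cylinders_but
  (fun=> setT) (fun=> cylinders_butT) _ (mrestr (P j) mD1)
  (mscale (NngNum e0) (mrestr (P j) mYa)) setI_closed_cylinders_but).
- by apply/seteqP; split => // w _; exists 0%N.
- by move=> A GA; exact: independent_holding_time_cylinder.
- by move=> _; rewrite /= /mrestr setTI (le_lt_trans (probability_le1 _ mD1))// ltry.
Qed.

End independence.

(** * Sums with an independent exponential variable *)

Section discretisation.
Context (R : realType).

(** Rounds down to a multiple of 1/(n+1), so that a rounded random variable takes countably many
    values. *)
Definition grid_floor (n : nat) (x : R) : R := (Num.truncn (x * n.+1%:R))%:R / n.+1%:R.

Lemma grid_floor_itv n x : 0 <= x -> x - n.+1%:R^-1 <= grid_floor n x <= x.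
Proof.
move=> x0; have xn0 : 0 <= x * n.+1%:R by rewrite mulr_ge0.
have /andP[h1 h2] := truncn_itv xn0.
have n0 : 0 < n.+1%:R :> R by [].
rewrite /grid_floor ler_pdivrMr// h1 andbT ler_pdivlMr// mulrBl mulVf ?gt_eqF//.
by rewrite lerBlDr natr1 ltW.
Qed.

Lemma cvg_grid_floor x : 0 <= x -> grid_floor ^~ x @ \oo --> x.
Proof.
move=> x0; apply: (@squeeze_cvgr _ _ _ _ (fun n => x - n.+1%:R^-1) (fun=> x)).
- by apply: nearW => n; exact: grid_floor_itv.
- by rewrite -[X in _ --> X]subr0; apply: cvgB; [exact: cvg_cst|exact: cvg_harmonic].
- exact: cvg_cst.
Qed.

Lemma measurable_grid_index d (T : measurableType d) (S : T -> R) n :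
  measurable_fun setT S -> (forall w, 0 <= S w) ->
  measurable_fun setT (fun w => Num.truncn (S w * n.+1%:R)).
Proof.
move=> mS S0 _ B _; rewrite setTI.
rewrite (_ : _ @^-1` B = \bigcup_(m in B) [set w | Num.truncn (S w * n.+1%:R) = m]); last first.
  by apply/seteqP; split => [w Bw|w [m Bm /= ->]//]; exists (Num.truncn (S w * n.+1%:R)).
apply: bigcup_measurable => m _.
have mSn : measurable_fun setT (fun w => S w * n.+1%:R) by exact: measurable_funM.
rewrite (_ : mkset _ = setT `&` (fun w => S w * n.+1%:R) @^-1` `[m%:R, m.+1%:R[).
  exact: mSn.
rewrite setTI; apply/seteqP; split => w /=; rewrite in_itv/=.
  by move=> <-; apply: truncn_itv; rewrite mulr_ge0.
exact: truncn_def.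
Qed.

End discretisation.

Lemma continuous_max0 (R : realType) : continuous (fun y : R => Num.max 0 y).
Proof.
move=> y; apply: (@continuous_max R R (fun=> 0) id); first exact: cvg_cst.
exact: cvg_id.
Qed.

Lemma integral_expR_segment (R : realType) (q s t : R) : s <= t ->
  (\int[lebesgue_measure]_(u in `[s, t]) (q * expR (- q * (t - u)))%:E =
   (1 - expR (- q * (t - s)))%:E)%E.
Proof.
rewrite le_eqVlt => /predU1P[->|st].
  by rewrite set_itv1 integral_set1 subrr mulr0 expR0 subrr.
have dF (x : R) : is_derive x (1 : R) (fun u : R => expR (- q * (t - u))) (q * expR (- q * (t - x))).
  rewrite (_ : (fun u : R => _) = (fun u : R => expR (- q * t) * expR (q * u))); last first.
    by apply/funext => u; rewrite -expRD; congr expR; ring.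
  have := @is_derive_expRZ R q x => h.
  apply: is_derive_eq; rewrite /GRing.scale/=.
  by rewrite mulrCA -expRD; congr (_ * expR _); ring.
have cF : continuous (fun u : R => expR (- q * (t - u))).
  by move=> x; apply: differentiable_continuous; apply/derivable1_diffP; have [] := dF x.
rewrite (@continuous_FTC2 _ _ (fun u : R => expR (- q * (t - u))))//.
- by rewrite subrr mulr0 expR0 EFinB.
- by apply: continuous_subspaceT => x; apply: cvgM; [exact: cvg_cst|exact: cF].
- split.
  + by move=> x _; have [] := dF x.
  + by apply: cvg_at_right_filter; exact: cF.
  + by apply: cvg_at_left_filter; exact: cF.
- by move=> x _; rewrite derive1E; have [] := dF x.
Qed.

Section exponential_sum.
Context d (T : measurableType d) (R : realType) (P : probability T R).
Variables (C : set T) (S H : T -> R) (q : R).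
Hypothesis q0 : 0 <= q.
Hypothesis mC : measurable C.
Hypothesis mS : measurable_fun setT S.
Hypothesis mH : measurable_fun setT H.
Hypothesis S0 : forall w, 0 <= S w.
Hypothesis H0 : forall w, 0 < H w.
Hypothesis indep : forall (t : R) (B : set R), 0 <= t -> measurable B ->
  (P (C `&` S @^-1` B `&` [set w | (t < H w)%R]) =
   (expR (- q * t))%:E * P (C `&` S @^-1` B))%E.

Let mexp (f : T -> R) (x : R) : measurable_fun setT f ->
  measurable_fun setT (fun w => (expR (- q * Num.max 0 (x - f w)))%:E).
Proof.
move=> mf; apply/measurable_EFinP; apply: measurableT_comp => //.
apply: measurable_funM => //; apply: measurable_maxr => //.
exact: measurable_funB.
Qed.

Let mtail (f : T -> R) (x : R) : measurable_fun setT f ->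
  measurable [set w | x < f w + H w].
Proof.
move=> mf; have m : measurable_fun setT (fun w => f w + H w) by exact: measurable_funD.
by rewrite -[X in measurable X]setTI -preimage_itvoy; exact: m.
Qed.

Let mgrid n : measurable_fun setT (fun w => grid_floor n (S w)).
Proof.
have h := @measurable_fun_fiber _ T _ R (fun w => Num.truncn (S w * n.+1%:R))
  (fun m _ => m%:R / n.+1%:R).
apply: h => //.
exact: measurable_grid_index.
Qed.

(** On the event that the rounded S equals c, the condition x < c + H is a tail event of H and
    independence applies. The level is max(0, x - c), since H > 0 makes the condition certain for x
    < c. *)
Let grid_tail n (x : R) :
  (\int[P]_(w in C) (\1_[set w | (x < grid_floor n (S w) + H w)%R] w)%:E =
   \int[P]_(w in C) (expR (- q * Num.max 0 (x - grid_floor n (S w))))%:E)%E.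
Proof.
have mN := measurable_grid_index n mS S0.
apply: (eq_integral_fiber mN) => //.
- by apply/measurable_EFinP; apply: measurable_funTS; apply: measurable_indic; exact: mtail.
- by apply: measurable_funTS; exact: mexp.
move=> m; set Cm := C `&` _.
have [B mB CmE] : exists2 B : set R, measurable B & Cm = C `&` S @^-1` B.
  exists ((fun x : R => x * n.+1%:R) @^-1` `[m%:R, m.+1%:R[%classic).
    rewrite -[X in measurable X]setTI.
    exact: (@measurable_funM _ _ _ setT (fun x : R => x) (fun=> n.+1%:R)).
  rewrite /Cm; congr (_ `&` _); apply/seteqP; split => w /=; rewrite in_itv/=.
    by move=> <-; apply: truncn_itv; rewrite mulr_ge0.
  exact: truncn_def.
have mCm : measurable Cm by apply: measurableI => //; exact: measurable_fiber.
pose c := m%:R / n.+1%:R : R.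
rewrite [RHS](eq_integral (cst (expR (- q * Num.max 0 (x - c)))%:E)); last first.
  by move=> w; rewrite inE => -[_ /= Nm]; rewrite /grid_floor Nm.
rewrite [RHS]integral_cst// integral_indic//; last exact: mtail.
rewrite CmE -indep ?le_max ?lexx//; congr (P _).
rewrite setIC -CmE; apply/seteqP; split => w /= [[Cw Nm]] h; split => //.
  by move: h; rewrite /grid_floor Nm gt_max H0/= ltrBlDl.
by move: h; rewrite /grid_floor Nm gt_max H0/= ltrBlDl.
Qed.

(** Dominated convergence in [grid_tail]. The rounding approaches S from below, so the indicators of
    the strict inequality are eventually constant at each point. *)
Lemma exponential_sum_tail (x : R) :
  (P (C `&` [set w | (x < S w + H w)%R]) =
   \int[P]_(w in C) (expR (- q * Num.max 0 (x - S w)))%:E)%E.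
Proof.
have int1 : P.-integrable C (cst 1%E).
  by apply: finite_measure_integrable_cst.
have e01 y : expR (- q * Num.max 0 y) <= 1.
  by rewrite -expR0 ler_expR mulNr oppr_le0 mulr_ge0// le_max lexx.
have lhs : (\int[P]_(w in C) (\1_[set w | (x < grid_floor n (S w) + H w)%R] w)%:E)%E
    @[n --> \oo] --> P (C `&` [set w | (x < S w + H w)%R]).
  rewrite (_ : P _ = \int[P]_(w in C) (\1_[set w | (x < S w + H w)%R] w)%:E)%E; last first.
    by rewrite integral_indic ?(setIC C)//; exact: mtail.
  apply: (@dominated_cvg _ _ _ _ _ mC _ _ (cst 1%E)) => //.
  - by move=> n; apply/measurable_EFinP; apply: measurable_funTS; apply: measurable_indic; exact: mtail.
  - move=> w Cw; apply: cvg_near_cst; have := cvg_grid_floor (S0 w) => cg.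
    have [xS|Sx] := ltP x (S w + H w).
      have xSH : x - H w < S w by rewrite ltrBlDr.
      near=> n; rewrite !indicE !mem_set//= -ltrBlDr; near: n.
      exact: (cvgr_gt _ cg).
    near=> n; rewrite !indicE !memNset//=; apply/negP; rewrite -leNgt//.
    by apply: le_trans Sx; rewrite lerD2r; have /andP[] := grid_floor_itv n (S0 w).
  - by move=> n w _; rewrite gee0_abs ?lee_fin ?indicE//; case: (_ \in _).
have rhs : (\int[P]_(w in C) (expR (- q * Num.max 0 (x - grid_floor n (S w))))%:E)%E
    @[n --> \oo] --> (\int[P]_(w in C) (expR (- q * Num.max 0 (x - S w)))%:E)%E.
  apply: (@dominated_cvg _ _ _ _ _ mC _ _ (cst 1%E)) => //.
  - by move=> n; apply: measurable_funTS; exact: mexp.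
  - move=> w Cw; apply: cvg_EFin; first exact: nearW.
    apply: (@cvg_comp _ _ _ _ expR _ (nbhs (- q * Num.max 0 (x - S w)))); last exact: continuous_expR.
    apply: cvgMr; apply: (cvg_comp (fun n => x - grid_floor n (S w)) (fun y => Num.max 0 y)); last exact: continuous_max0.
    by apply: cvgB; [exact: cvg_cst|exact: cvg_grid_floor].
  - by move=> n w _; rewrite gee0_abs ?lee_fin ?expR_ge0.
move: rhs; rewrite -(funext (fun n => grid_tail n x)) => rhs.
exact: (cvg_unique _ lhs rhs).
Unshelve. all: by end_near. Qed.

(** For S <= t, the conditional probability 1 - exp(-q (t - S)) is the integral of q exp(-q (t - u))
    over u in [S, t]; [tonelli_cdf] then yields the convolution. *)
Lemma exponential_sum_cdf (t : R) : 0 <= t ->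
  (P (C `&` [set w | (S w + H w <= t)%R]) =
   \int[lebesgue_measure]_(u in `[0%R, t]) ((q * expR (- q * (t - u)))%:E *
     P (C `&` [set w | (S w <= u)%R])))%E.
Proof.
move=> t0; have mSle (u : R) : measurable [set w | S w <= u].
  by rewrite -[X in measurable X]setTI -preimage_itvNyc; exact: mS.
have mSHle : measurable [set w | S w + H w <= t].
  have m : measurable_fun setT (fun w => S w + H w) by exact: measurable_funD.
  by rewrite -[X in measurable X]setTI -preimage_itvNyc; exact: m.
have mh : measurable_fun setT (fun u : R => q * expR (- q * (t - u))).
  apply: measurable_funM => //; apply: measurableT_comp => //.
  by apply: measurable_funM => //; exact: measurable_funB.
transitivity (\int[lebesgue_measure]_(u in `[0%R, t]) ((q * expR (- q * (t - u)))%:E *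
    \int[P]_(w in C `&` [set w | (S w <= u)%R]) (cst 1%R w)%:E))%E; last first.
  by apply: eq_integral => u _; rewrite (eq_integral (cst 1%E))// integral_cst ?mul1e//;
    exact: measurableI.
rewrite -tonelli_cdf//; last by move=> u; rewrite mulr_ge0 ?expR_ge0.
pose e w := expR (- q * Num.max 0 (t - S w)).
transitivity (\int[P]_(w in C) (1 - e w)%:E)%E; last first.
  apply: eq_integral => w _; rewrite mul1e /e; case: (leP (S w) t) => St.
    rewrite (_ : _ `&` _ = `[S w, t]%classic).
      by rewrite integral_expR_segment// max_r// subr_ge0.
    apply/seteqP; split => u /=; rewrite !in_itv/= andbT; first by move=> [/andP[_ ->]] ->.
    by move=> /andP[Su ut]; rewrite Su ut (le_trans (S0 w) Su).
  rewrite (_ : _ `&` _ = set0); last first.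
    apply/seteqP; split => // u /=; rewrite !in_itv/= andbT => -[/andP[_ ut] Su].
    by move: (le_trans Su ut); rewrite leNgt St.
  by rewrite integral_set0 max_l ?subr_le0 ?ltW// mulr0 expR0 subrr.
have e01 w : 0 <= e w <= 1.
  by rewrite expR_ge0/= -expR0 ler_expR mulNr oppr_le0 mulr_ge0// le_max lexx.
have me : measurable_fun setT e by apply/measurable_EFinP; exact: mexp.
have h1 : (P (C `&` [set w | (S w + H w <= t)%R]) + \int[P]_(w in C) (e w)%:E = P C)%E.
  rewrite -exponential_sum_tail -measureU; first last.
  - by apply/seteqP; split => // w [[_ /= h] [_ /=]]; rewrite ltNge h.
  - by apply: measurableI => //; exact: mtail.
  - exact: measurableI.
  rewrite -setIUr; congr (P _); apply/seteqP; split => [w []//|w Cw]; split => //=.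
  by case: (leP (S w + H w) t) => ?; [left|right].
have h2 : (\int[P]_(w in C) (1 - e w)%:E + \int[P]_(w in C) (e w)%:E = P C)%E.
  rewrite -ge0_integralD//.
  - rewrite (eq_integral (cst 1%E)); last by move=> w _; rewrite -EFinD subrK.
    by rewrite integral_cst// mul1e.
  - by move=> w _; have /andP[_ ?] := e01 w; rewrite lee_fin subr_ge0.
  - by apply/measurable_EFinP; apply: measurable_funTS; exact: measurable_funB.
  - by move=> w _; have /andP[? _] := e01 w; rewrite lee_fin.
  - by apply/measurable_EFinP; exact: measurable_funTS.
have fin : (\int[P]_(w in C) (e w)%:E)%E \is a fin_num.
  rewrite -exponential_sum_tail fin_num_measure//.
  by apply: measurableI => //; exact: mtail.
by rewrite -[LHS](addeK _ fin) -[RHS](addeK _ fin) h1 h2.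
Qed.

End exponential_sum.

(** * The hitting time as a sum of holding times *)

Section passage_cdf.
Context (R : realType) (E : set nat) (q : nat -> nat -> R).
Context d (Omega : measurableType d) (P : nat -> probability Omega R).
Variables (Y : nat -> Omega -> nat) (H : nat -> Omega -> R).
Hypothesis lq : local_rates E q.
Hypothesis mY : forall n, measurable_fun setT (Y n).
Hypothesis mH : forall n, measurable_fun setT (H n).
Hypothesis YE : forall n w, E (Y n w).
Hypothesis H_gt0 : forall n w, 0 < H n w.
Hypothesis law : has_jump_law E q P Y H.
Variable k : nat.
Local Notation ex := (exit_rate q).
Local Notation Sigma a := (<<s cylinders_but Y H a >>).

Lemma Sigma_state a m : @measurable_fun _ _ (g_sigma_algebraType (cylinders_but Y H a)) nat setT (Y m).
Proof.
move=> _ B _; rewrite setTI; apply: sub_sigma_algebra.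
exists m, (fun l => if l == m then B else setT), (fun=> 0); split => //.
  by move=> l ml; rewrite gtn_eqF.
apply/seteqP; split => w /= h; last by have [] := h m; rewrite eqxx.
by move=> l; split => //; case: eqP => // ->.
Qed.

Lemma Sigma_holding a m : m != a ->
  @measurable_fun _ _ (g_sigma_algebraType (cylinders_but Y H a)) R setT (H m).
Proof.
move=> ma; apply: (measurability (RGenOInfty.G (R := R))); first exact: RGenOInfty.measurableE.
move=> _ [_ [x ->] <-]; rewrite setTI preimage_itvoy; apply: sub_sigma_algebra.
have [x0|x0] := leP 0 x.
  exists m, (fun=> setT), (fun l => if l == m then x else 0); split => //.
  - by move=> l; case: ifP.
  - by move=> l ml; rewrite gtn_eqF.
  apply/seteqP; split => w /= h.
    by move=> l; split => // la; case: eqP => [->|].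
  by have [_ /(_ ma)] := h m; rewrite eqxx.
rewrite (_ : mkset _ = setT); first exact: cylinders_butT.
by apply/seteqP; split => // w _ /=; exact: lt_trans (H_gt0 m w).
Qed.

(** When [p] excludes the index a, this is measurable for the sigma-algebra that omits the a-th
    holding time, hence independent of that time given [Y a]. *)
Definition partial_hit_time (p : pred nat) (w : Omega) : R :=
  \sum_(m < hit_index Y k w | p m) H m w.

Lemma partial_hit_time_ge0 p w : 0 <= partial_hit_time p w.
Proof. by apply: sumr_ge0 => m _; exact: ltW. Qed.

Lemma Sigma_partial_hit_time a (p : pred nat) : (forall m, p m -> m != a) ->
  @measurable_fun _ _ (g_sigma_algebraType (cylinders_but Y H a)) R setT (partial_hit_time p).
Proof.
move=> pa.
apply: (@measurable_fun_fiber _ (g_sigma_algebraType (cylinders_but Y H a)) _ R (hit_index Y k)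
  (fun n w => \sum_(m < n | p m) H m w)).
  by apply: measurable_hit_index => n; exact: Sigma_state.
move=> n; under eq_fun do rewrite big_mkcond/=.
apply: (@measurable_sum _ (g_sigma_algebraType (cylinders_but Y H a))) => m.
by case pm : (p m) => //; apply: Sigma_holding; exact: pa.
Qed.

Lemma Sigma_hit_event a : Sigma a (hit_event Y k).
Proof.
exact: (@measurable_hit_event _ (g_sigma_algebraType (cylinders_but Y H a)) Y k (@Sigma_state a)).
Qed.

Lemma Sigma_hit_index a n : Sigma a [set w | (n < hit_index Y k w)%N].
Proof.
have := @measurable_hit_index _ (g_sigma_algebraType (cylinders_but Y H a)) Y k (@Sigma_state a).
by move=> /(_ measurableT [set l | (n < l)%N]); rewrite setTI; exact.
Qed.

Lemma SigmaI a B C : Sigma a B -> Sigma a C -> Sigma a (B `&` C).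
Proof. exact: (@measurableI _ (g_sigma_algebraType (cylinders_but Y H a))). Qed.

Lemma Sigma_measurable a : Sigma a `<=` measurable.
Proof.
apply: smallest_sub; first exact: sigma_algebra_measurable.
exact: measurable_cylinders_but.
Qed.

Lemma Sigma_preimage a (S : Omega -> R) (B : set R) :
  @measurable_fun _ _ (g_sigma_algebraType (cylinders_but Y H a)) R setT S ->
  measurable B -> Sigma a (S @^-1` B).
Proof. by move=> mS mB; have := mS measurableT B mB; rewrite setTI. Qed.

Lemma independent_preimage j a i C (S : Omega -> R) : E j -> Sigma a C ->
  @measurable_fun _ _ (g_sigma_algebraType (cylinders_but Y H a)) R setT S ->
  forall (t : R) (B : set R), 0 <= t -> measurable B ->
  (P j ((C `&` [set w | Y a w = i]) `&` S @^-1` B `&` [set w | (t < H a w)%R]) =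
   (expR (- ex i * t))%:E * P j ((C `&` [set w | Y a w = i]) `&` S @^-1` B))%E.
Proof.
move=> Ej SC mS t B t0 mB.
have SB := SigmaI SC (Sigma_preimage mS mB).
have := independent_holding_time lq mY mH YE H_gt0 law i Ej t0 SB.
by rewrite !(setIAC C _ (S @^-1` B)) -(setIA (C `&` S @^-1` B)).
Qed.

Lemma Sigma_fun_measurable a (S : Omega -> R) :
  @measurable_fun _ _ (g_sigma_algebraType (cylinders_but Y H a)) R setT S ->
  measurable_fun setT S.
Proof.
by move=> mS _ B mB; rewrite setTI; apply: (@Sigma_measurable a); exact: Sigma_preimage.
Qed.

(** The rate of the a-th holding time depends on the random state [Y a]; [exponential_sum_tail] is
    applied on each of its fibres. *)
Lemma holding_sum_tail j a C (S : Omega -> R) (x : R) : E j -> Sigma a C ->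
  @measurable_fun _ _ (g_sigma_algebraType (cylinders_but Y H a)) R setT S ->
  (forall w, 0 <= S w) ->
  (P j (C `&` [set w | (x < S w + H a w)%R]) =
   \int[P j]_(w in C) (expR (- ex (Y a w) * Num.max 0 (x - S w)))%:E)%E.
Proof.
move=> Ej SC mS S0; have mS' := Sigma_fun_measurable mS.
have mC := Sigma_measurable SC.
have mx : measurable [set w | x < S w + H a w].
  have m : measurable_fun setT (fun w => S w + H a w) by exact: measurable_funD.
  by rewrite -[X in measurable X]setTI -preimage_itvoy; exact: m.
have mD := measurableI _ _ mC mx.
have -> : P j (C `&` [set w | x < S w + H a w]) =
    (\int[P j]_(w in C `&` [set w | (x < S w + H a w)%R]) cst 1 w)%E.
  by rewrite integral_cst// mul1e.
have me : measurable_fun setT (fun w => (expR (- ex (Y a w) * Num.max 0 (x - S w)))%:E).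
  apply/measurable_EFinP; apply: measurableT_comp => //; apply: measurable_funM.
    by have h := @measurable_fun_fiber _ Omega _ R (Y a) (fun n _ => - ex n); apply: h.
  by apply: measurable_maxr => //; exact: measurable_funB.
apply: (eq_integral_fiber (mY a)) => //.
  by apply: measurable_funTS.
move=> i; have [Ei|nEi] := pselect (E i); last first.
  have h D : D `&` [set w | Y a w = i] = set0.
    by apply/seteqP; split => // w [_ /= Yi]; apply: nEi; rewrite -Yi.
  by rewrite !h !integral_set0.
have mCi : measurable (C `&` [set w | Y a w = i]).
  by apply: measurableI => //; exact: measurable_fiber.
rewrite setIAC integral_cst ?mul1e; last exact: measurableI.
rewrite [RHS](eq_integral (fun w => (expR (- ex i * Num.max 0 (x - S w)))%:E)); last first.
  by move=> w; rewrite inE => -[_ /= ->].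
apply: exponential_sum_tail => //.
  by rewrite ltW// (exit_rate_gt0 lq).
exact: independent_preimage.
Qed.

End passage_cdf.

(** * Density of the passage time *)

Section passage_density.
Context (R : realType) (E : set nat) (q : nat -> nat -> R).
Context d (Omega : measurableType d) (P : nat -> probability Omega R).
Variables (Y : nat -> Omega -> nat) (H : nat -> Omega -> R).
Variable X : R -> Omega -> option nat.
Hypothesis lq : local_rates E q.
Hypothesis mY : forall n, measurable_fun setT (Y n).
Hypothesis mH : forall n, measurable_fun setT (H n).
Hypothesis YE : forall n w, E (Y n w).
Hypothesis H_gt0 : forall n w, 0 < H n w.
Hypothesis pathX : is_jump_path Y H X.
Hypothesis law : has_jump_law E q P Y H.
Variables k j : nat.
Hypothesis Ej : E j.
Hypothesis jk : j <> k.
Local Notation ex := (exit_rate q).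
Notation mu := (@lebesgue_measure R).

Let ex_gt0 : 0 < ex j. Proof. exact: (exit_rate_gt0 lq). Qed.

Lemma probability_not_initial B : measurable B ->
  P j (B `&` ~` [set w | Y 0%N w = j]) = 0%E.
Proof.
move=> mB; have mY0 : measurable [set w | Y 0%N w = j] by exact: measurable_fiber.
have Y0 : P j [set w | Y 0%N w = j] = 1%E.
  have := jump_law_path lq law (n := 0%N) (i := fun=> j) (s := fun=> 0) Ej (fun _ _ => Ej) (fun _ _ => lexx 0).
  rewrite eqxx big_ord0 mulr1 => <-; congr (P j _).
  by apply/seteqP; split => w /=; [move=> Y0; split => // m; rewrite leqn0 => /eqP->|case=> /(_ 0%N (leqnn 0))].
have Y0C : P j (~` [set w | Y 0%N w = j]) = 0%E.
  by rewrite probability_setC// Y0 subee.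
apply/eqP; rewrite -measure_le0 -[leRHS]Y0C; apply: le_measure; rewrite ?inE.
- by apply: measurableI => //; exact: measurableC.
- exact: measurableC.
- exact: subIsetr.
Qed.

Lemma probability_initial B : measurable B ->
  P j (B `&` [set w | Y 0%N w = j]) = P j B.
Proof.
move=> mB; have mY0 : measurable [set w | Y 0%N w = j] by exact: measurable_fiber.
have -> : P j B = (P j (B `&` [set w | Y 0%N w = j]) + P j (B `&` ~` [set w | Y 0%N w = j]))%E.
  rewrite -measureU -?setIUr ?setUv ?setIT//.
  - exact: measurableI.
  - by apply: measurableI => //; exact: measurableC.
  - by apply/seteqP; split => // w [[_ ?] [_]].
by rewrite probability_not_initial// adde0.
Qed.

(** On [C] the chain starts at j and hits k after at least one jump; [C2] asks for at least two.
    [S0] is the hitting time without the first holding time, [S1] without the first two, and [F] and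
    [G] below are the distribution functions of [S0 + H 0] and [S0] on [C], possibly defective. *)
Let C := (hit_event Y k `&` [set w | (0 < hit_index Y k w)%N]) `&` [set w | Y 0%N w = j].
Let S0 := partial_hit_time Y H k (fun m => m != 0%N).
Let C2 := C `&` [set w | (1 < hit_index Y k w)%N].
Let S1 := partial_hit_time Y H k (fun m => (1 < m)%N).

Let SigmaC a : (<<s cylinders_but Y H a >>) C.
Proof.
apply: SigmaI; last first.
  have h := @Sigma_state R d Omega Y H H_gt0 a 0%N measurableT [set j].
  by rewrite setTI in h; exact: h.
by apply: SigmaI; [exact: Sigma_hit_event|exact: Sigma_hit_index].
Qed.

Let mC : measurable C.
Proof. exact: (Sigma_measurable mY mH (@SigmaC 0%N)). Qed.

Let SigmaC2 : (<<s cylinders_but Y H 1 >>) C2.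
Proof. by apply: SigmaI; [exact: SigmaC|exact: Sigma_hit_index]. Qed.

Let mC2 : measurable C2.
Proof. exact: (Sigma_measurable mY mH SigmaC2). Qed.

Let sS0 : @measurable_fun _ _ (g_sigma_algebraType (cylinders_but Y H 0)) R setT S0.
Proof. exact: Sigma_partial_hit_time. Qed.

Let sS1 : @measurable_fun _ _ (g_sigma_algebraType (cylinders_but Y H 1)) R setT S1.
Proof. by apply: Sigma_partial_hit_time => // m m1; rewrite gtn_eqF. Qed.

Let mS0 : measurable_fun setT S0. Proof. exact: Sigma_fun_measurable sS0. Qed.
Let mS1 : measurable_fun setT S1. Proof. exact: Sigma_fun_measurable sS1. Qed.
Let S0_ge0 w : 0 <= S0 w. Proof. exact: partial_hit_time_ge0. Qed.
Let S1_ge0 w : 0 <= S1 w. Proof. exact: partial_hit_time_ge0. Qed.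

Let mle (f : Omega -> R) (t : R) : measurable_fun setT f -> measurable [set w | f w <= t].
Proof. by move=> mf; rewrite -[X in measurable X]setTI -preimage_itvNyc; exact: mf. Qed.

Let mlt (f : Omega -> R) (t : R) : measurable_fun setT f -> measurable [set w | t < f w].
Proof. by move=> mf; rewrite -[X in measurable X]setTI -preimage_itvoy; exact: mf. Qed.

Let hit_time_S0 w : C w -> hit_time Y H k w = S0 w + H 0 w.
Proof.
move=> [[_ /= h0] _]; rewrite /hit_time /jump_time /S0 /partial_hit_time.
by rewrite (bigD1 (Ordinal h0))//= addrC.
Qed.

Let S0_S1 w : C2 w -> S0 w = S1 w + H 1 w.
Proof.
move=> [_ /= h1]; rewrite /S1 /S0 /partial_hit_time.
rewrite (bigD1 (Ordinal h1))//= addrC; congr (_ + _); apply: eq_bigl => m.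
by rewrite -val_eqE /=; case: (val m) => [|[|]].
Qed.

Let S0_0 w : C w -> ~ (1 < hit_index Y k w)%N -> S0 w = 0.
Proof.
move=> [[_ /= h0] _] h1; rewrite /S0 /partial_hit_time big1// => m m0.
by exfalso; apply: h1; apply: leq_ltn_trans (ltn_ord m); rewrite lt0n.
Qed.

Let F (t : R) : R := fine (P j (C `&` [set w | S0 w + H 0 w <= t])).
Let G (u : R) : R := fine (P j (C `&` [set w | S0 w <= u])).

Let mS0H : measurable_fun setT (fun w => S0 w + H 0 w).
Proof. exact: measurable_funD. Qed.

Let FE t : P j (C `&` [set w | S0 w + H 0 w <= t]) = (F t)%:E.
Proof. by rewrite /F fineK// fin_num_measure//; apply: measurableI => //; exact: mle. Qed.

Let GE t : P j (C `&` [set w | S0 w <= t]) = (G t)%:E.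
Proof. by rewrite /G fineK// fin_num_measure//; apply: measurableI => //; exact: mle. Qed.

Let passage_cdfE t : fine (P j [set w | (passage_time X k w <= t%:E)%E]) = F t.
Proof.
have -> : [set w | (passage_time X k w <= t%:E)%E] =
    hit_event Y k `&` [set w | hit_time Y H k w <= t].
  apply/seteqP; split => w /=; rewrite (passage_timeE H_gt0 pathX); case: ifPn => hw.
  - by rewrite lee_fin => ?; split=> //; exact: set_mem.
  - by rewrite leye_eq.
  - by move=> [_]; rewrite lee_fin.
  - by move=> [/mem_set]; rewrite (negbTE hw).
rewrite -probability_initial; last first.
  by apply: measurableI; [exact: measurable_hit_event|apply: mle; exact: measurable_hit_time].
rewrite /F; congr (fine (P j _)); apply/seteqP; split => w /=.
  move=> [[hw ht] Y0].
  have Cw : C w.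
    split => //; split => //=; rewrite lt0n; apply/eqP => h0.
    by have [] := hit_indexP hw; rewrite h0 Y0.
  by split => //; rewrite -hit_time_S0.
by move=> [Cw]; rewrite -hit_time_S0// => ht; case: Cw => -[hw _] Y0.
Qed.

Let indep0 (t : R) (B : set R) : 0 <= t -> measurable B ->
  (P j (C `&` S0 @^-1` B `&` [set w | (t < H 0 w)%R]) =
   (expR (- ex j * t))%:E * P j (C `&` S0 @^-1` B))%E.
Proof.
move=> t0 mB; rewrite /C; apply: (independent_preimage lq) => //.
by apply: SigmaI; [exact: Sigma_hit_event|exact: Sigma_hit_index].
Qed.

Let F_conv t : 0 <= t ->
  ((F t)%:E = \int[mu]_(u in `[0%R, t]) (ex j * expR (- ex j * (t - u)) * G u)%:E)%E.
Proof.
move=> t0; rewrite -FE (@exponential_sum_cdf _ _ _ (P j) C S0 (H 0) (ex j))//.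
  by apply: eq_integral => u _; rewrite GE -EFinM.
exact: ltW.
Qed.

Let G_nd : {homo G : x y / x <= y}.
Proof.
move=> x y xy; rewrite -lee_fin -!GE; apply: le_measure; rewrite ?inE.
- by apply: measurableI => //; exact: mle.
- by apply: measurableI => //; exact: mle.
- by move=> w [Cw /= h]; split => //=; exact: le_trans xy.
Qed.

Let F_nd : {homo F : x y / x <= y}.
Proof.
move=> x y xy; rewrite -lee_fin -!FE; apply: le_measure; rewrite ?inE.
- by apply: measurableI => //; exact: mle.
- by apply: measurableI => //; exact: mle.
- by move=> w [Cw /= h]; split => //=; exact: le_trans xy.
Qed.

Let FG t : F t <= G t.
Proof.
rewrite -lee_fin -FE -GE; apply: le_measure; rewrite ?inE.
- by apply: measurableI => //; exact: mle.
- by apply: measurableI => //; exact: mle.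
- by move=> w [Cw /= h]; split => //=; apply: le_trans h; rewrite lerDl ltW.
Qed.

Let F_ge0 t : 0 <= F t. Proof. by rewrite /F fine_ge0. Qed.
Let G_ge0 t : 0 <= G t. Proof. by rewrite /G fine_ge0. Qed.
Let G_le1 t : G t <= 1.
Proof. by rewrite -lee_fin -GE probability_le1//; apply: measurableI => //; exact: mle. Qed.

Let tail1 (u : R) w : R := expR (- ex (Y 1 w) * Num.max 0 (u - S1 w)).

Let tail1_01 u w : 0 <= tail1 u w <= 1.
Proof.
rewrite expR_ge0/= -expR0 ler_expR mulNr oppr_le0 mulr_ge0// ?le_max ?lexx//.
by rewrite ltW// (exit_rate_gt0 lq).
Qed.

Let mtail1 u : measurable_fun setT (tail1 u).
Proof.
apply: measurableT_comp => //; apply: measurable_funM.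
  by have h := @measurable_fun_fiber _ Omega _ R (Y 1) (fun n _ => - ex n); apply: h.
by apply: measurable_maxr => //; exact: measurable_funB.
Qed.

Let int_tail1 u : (P j).-integrable C2 (EFin \o tail1 u).
Proof.
apply: measurable_bounded_integrable => //.
- by rewrite (le_lt_trans (probability_le1 _ mC2))// ltry.
- exact: measurable_funTS.
exists 1; split; first exact: num_real.
move=> x x1 w _ /=; have /andP[h0 h1] := tail1_01 u w.
by rewrite ger0_norm// (le_trans h1)// ltW.
Qed.

(** If k is hit at the first jump then S0 = 0, an atom that is constant in u >= 0. Otherwise S0 = S1
    + H 1, whose tail is an integral by [holding_sum_tail]. *)
Let G_tail u : 0 <= u ->
  G u = fine (P j (C `&` ~` [set w | (1 < hit_index Y k w)%N])) + fine (P j C2)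
        - \int[P j]_(w in C2) tail1 u w.
Proof.
move=> u0.
have mB : measurable [set w | (1 < hit_index Y k w)%N].
  by apply: (@Sigma_measurable _ _ _ Y H mY mH 0); exact: Sigma_hit_index.
have mD1 : measurable (C `&` ~` [set w | (1 < hit_index Y k w)%N]).
  by apply: measurableI => //; exact: measurableC.
have mS1H : measurable_fun setT (fun w => S1 w + H 1 w) by exact: measurable_funD.
have mD2 : measurable (C2 `&` [set w | S1 w + H 1 w <= u]).
  by apply: measurableI => //; exact: mle.
have h1 : P j (C `&` [set w | S0 w <= u]) =
    (P j (C `&` ~` [set w | (1 < hit_index Y k w)%N]) + P j (C2 `&` [set w | (S1 w + H 1 w <= u)%R]))%E.
  rewrite -measureU//; last by apply/seteqP; split => // w [[_ ?] [[_ ?] _]].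
  congr (P j _); apply/seteqP; split => w /=.
    move=> [Cw Sw]; have [h|h] := pselect (1 < hit_index Y k w)%N; last by left.
    have C2w : C2 w by [].
    by right; split => //; rewrite -S0_S1.
  move=> [[Cw h]|[C2w h]]; first by split => //; rewrite S0_0.
  by have [Cw _] := C2w; split => //; rewrite S0_S1.
have h2 : (P j (C2 `&` [set w | (S1 w + H 1 w <= u)%R]) + \int[P j]_(w in C2) (tail1 u w)%:E = P j C2)%E.
  rewrite -(holding_sum_tail lq mY mH YE H_gt0 law u Ej SigmaC2 sS1 S1_ge0) -measureU//.
  - rewrite -setIUr; congr (P j _); apply/seteqP; split => [w []//|w Cw]; split => //=.
    by case: (leP (S1 w + H 1 w) u) => ?; [left|right].
  - by apply: measurableI => //; exact: mlt.
  - by apply/seteqP; split => // w [[_ /= h] [_ /=]]; rewrite ltNge h.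
have f1 : (\int[P j]_(w in C2) (tail1 u w)%:E)%E \is a fin_num.
  exact: integrable_fin_num (int_tail1 u).
rewrite /G h1 fineD ?fin_num_measure// -addrA; congr (_ + _).
by rewrite -h2 fineD ?fin_num_measure// /Rintegral addrK.
Qed.

(** The integrand [tail1] is continuous in u and bounded by 1. The point 0 is excluded because of
    the atom of S0. *)
Let G_cont u : 0 < u -> {for u, continuous G}.
Proof.
move=> u0.
have c : {in `]0%R, (u + 1)[%classic, continuous (fun l => \int[P j]_(w in C2) tail1 l w)}.
  apply: (@continuity_under_integral _ _ _ (P j) tail1 C2 mC2 0 (u + 1) _ _ (cst 1)).
  - by move=> x _; exact: int_tail1.
  - apply: aeW => w _ x _; rewrite /tail1.
    apply: (cvg_comp _ expR); last exact: continuous_expR.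
    apply: cvgMr; apply: (cvg_comp (fun x => x - S1 w) (fun y => Num.max 0 y)); last exact: continuous_max0.
    by apply: cvgB; [exact: cvg_id|exact: cvg_cst].
  - exact: finite_measure_integrable_cst.
  - move=> x _; apply: aeW => w _ /=; have /andP[h0 h1] := tail1_01 x w.
    by rewrite ger0_norm.
have uI : u \in (`]0%R, (u + 1)[%classic : set R) by rewrite inE/= in_itv/= u0 ltrDl ltr01.
have cu := c _ uI.
pose c0 := fine (P j (C `&` ~` [set w | (1 < hit_index Y k w)%N])) + fine (P j C2).
have : (fun x => c0 - \int[P j]_(w in C2) tail1 x w) @ u --> c0 - \int[P j]_(w in C2) tail1 u w.
  by apply: cvgB; [exact: cvg_cst|exact: cu].
move=> cc; suff : G x @[x --> u] --> G u by [].
rewrite [X in _ --> X](G_tail (ltW u0)); apply: cvg_trans cc; apply: near_eq_cvg.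
by near=> x; rewrite G_tail//; apply: ltW; near: x; exact: lt_nbhsr.
Unshelve. all: by end_near. Qed.

(** Factoring exp(-q t) out of the convolution kernel, with q the exit rate of j, leaves an
    integrand free of t, to which the fundamental theorem of calculus applies. *)
Let h (u : R) : R := ex j * expR (ex j * u) * G u.

Let mG D : measurable_fun D G.
Proof. by apply: measurable_funTS; exact: nondecreasing_measurable. Qed.

Let mF D : measurable_fun D F.
Proof. by apply: measurable_funTS; exact: nondecreasing_measurable. Qed.

Let mw (lam : R) (K : R -> R) D : measurable_fun setT K ->
  measurable_fun D (fun t : R => (lam * expR (- lam * t) * K t)%:E).
Proof.
move=> mK; apply/measurable_EFinP; apply: measurable_funTS.
apply: (@measurable_funM _ _ _ _ (fun t : R => lam * expR (- lam * t)) K) => //.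
apply: (@measurable_funM _ _ _ _ (fun t : R => lam) (fun t : R => expR (- lam * t))) => //.
exact: measurable_expRZ.
Qed.

Let int_h b : mu.-integrable `[0%R, b] (EFin \o h).
Proof.
apply: measurable_bounded_integrable => //.
- apply: (@le_lt_trans _ _ (lebesgue_measure (`[0%R, b]%classic : set R))); first exact: lexx.
  by rewrite lebesgue_measure_itv/=; case: ifP => _; rewrite ?ltry// -EFinD ltry.
- apply: (@measurable_funM _ _ _ _ (fun u => ex j * expR (ex j * u)) G) => //.
  apply: (@measurable_funM _ _ _ _ (fun u => ex j) (fun u => expR (ex j * u))) => //.
  exact: measurable_expRZ.
exists (ex j * expR (ex j * b)); split; first exact: num_real.
move=> x x1 u /=; rewrite in_itv/= => /andP[u0 ub].
have h0 : 0 <= h u by rewrite !mulr_ge0 ?expR_ge0// ltW.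
rewrite ger0_norm// (le_trans _ (ltW x1))// /h -[leRHS]mulr1.
apply: ler_pM => //; first by rewrite mulr_ge0 ?expR_ge0// ltW.
by rewrite ler_pM2l// ler_expR ler_pM2l.
Qed.

Let F_prim t : 0 <= t -> F t = expR (- ex j * t) * \int[mu]_(u in `[0%R, t]) h u.
Proof.
move=> t0; apply: EFin_inj; rewrite F_conv// EFinM /Rintegral fineK; last first.
  by apply: integrable_fin_num => //; exact: int_h.
rewrite -integralZl//.
apply: eq_integral => u _; rewrite -EFinM; congr EFin; rewrite /h.
rewrite (_ : - ex j * (t - u) = - ex j * t + ex j * u); last by ring.
by rewrite expRD; ring.
Qed.

Let dF (t : R) : 0 < t -> is_derive t (1 : R) F (ex j * (G t - F t)).
Proof.
move=> t0.
have ch : {for t, continuous h}.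
  apply: cvgM; last exact: G_cont.
  by apply: cvgM; [exact: cvg_cst|exact: continuous_expRZ].
have t1 : t < t + 1 by rewrite ltrDl.
have [dI IE] := @continuous_FTC1_closed _ h 0 t (t + 1) t1 (int_h (t + 1)) t0 ch.
pose I (x : R) := \int[mu]_(u in `[0%R, x]) h u.
have hI : is_derive t (1 : R) I (h t).
  by apply: DeriveDef; [exact: dI|rewrite -derive1E].
have hE : is_derive t (1 : R) (fun x : R => expR (- ex j * x)) (- ex j * expR (- ex j * t)).
  exact: is_derive_expRZ.
have hP : is_derive t (1 : R) ((fun x : R => expR (- ex j * x)) * I) (ex j * (G t - F t)).
  apply: is_derive_eq; rewrite /GRing.scale/= F_prim ?ltW// /h -/(I t).
  have : expR (- ex j * t) * expR (ex j * t) = 1 by rewrite -expRD mulNr addNr expR0.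
  set a := expR _; set b := expR _ => ab.
  by rewrite mulrBr -[X in _ = X - _]mulr1 -ab; ring.
apply: near_eq_is_derive hP.
by near=> x; rewrite F_prim//; apply: ltW; near: x; exact: lt_nbhsr.
Unshelve. all: by end_near. Qed.

Let int_cdf (D : set Omega) (S : Omega -> R) (lam : R) : 0 < lam ->
  measurable D -> measurable_fun setT S -> (forall w, 0 <= S w) ->
  (\int[P j]_(w in D) (expR (- lam * S w))%:E =
  \int[mu]_(t in `[0%R, +oo[) ((lam * expR (- lam * t))%:E * P j (D `&` [set w | (S w <= t)%R])))%E.
Proof.
move=> lam0 mD mS S_ge0.
under eq_integral do rewrite -[expR _]mul1r.
rewrite laplace_tonelli//; apply: eq_integral => t _; congr (_ * _)%E.
rewrite (eq_integral (cst 1%E))// integral_cst ?mul1e//.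
by apply: measurableI => //; exact: mle.
Qed.

Let hit_laplace_restrict (lam : R) : 0 < lam ->
  (\int[P j]_(w in C) (expR (- lam * (S0 w + H 0 w)))%:E = (hit_laplace P Y H k j lam)%:E)%E.
Proof.
move=> lam0; rewrite -(hit_laplaceE P mY mH H_gt0) ?ltW//.
have mhit := measurable_hit_event k mY.
have mY0 : measurable [set w | Y 0%N w = j] by exact: measurable_fiber.
have mhY : measurable (hit_event Y k `&` [set w | Y 0%N w = j]) by exact: measurableI.
have mhYC : measurable (hit_event Y k `&` ~` [set w | Y 0%N w = j]).
  by apply: measurableI => //; exact: measurableC.
have mexp D : measurable_fun D (fun w => (expR (- lam * hit_time Y H k w))%:E).
  by apply/measurable_EFinP; exact: measurable_exp_hit_time.
have hC : hit_event Y k `&` [set w | Y 0%N w = j] = C.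
  rewrite /C; apply/seteqP; split => w /=; last by case=> -[].
  move=> [hw Y0]; split => //; split => //=; rewrite lt0n; apply/eqP => h0.
  by have [] := hit_indexP hw; rewrite h0 Y0.
rewrite [in RHS](_ : hit_event Y k = (hit_event Y k `&` [set w | Y 0%N w = j]) `|`
  (hit_event Y k `&` ~` [set w | Y 0%N w = j])); last by rewrite -setIUr setUv setIT.
rewrite ge0_integral_setU//=; first last.
- by apply/disj_setPS => w [[_ ?] []].
rewrite [X in (_ = _ + X)%E](_ : _ = 0%E).
  by rewrite adde0 hC; apply: eq_integral => w; rewrite inE => Cw; rewrite hit_time_S0.
apply: null_set_integral => //.
exact: probability_not_initial.
Qed.

Let laplace_F (lam : R) : 0 < lam ->
  (\int[mu]_(t in `[0%R, +oo[) (lam * expR (- lam * t) * F t)%:E = (hit_laplace P Y H k j lam)%:E)%E.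
Proof.
move=> lam0; rewrite -hit_laplace_restrict//.
rewrite int_cdf//; last by move=> w; rewrite addr_ge0// ltW.
by apply: eq_integral => t _; rewrite FE -EFinM.
Qed.

(** Under the measure weighted by exp(-lam S0), H 0 is still exponential, so the transform of the
    hitting time is that of S0 times q / (lam + q), where q is the exit rate of j. *)
Let laplace_G (lam : R) : 0 < lam ->
  (\int[mu]_(t in `[0%R, +oo[) (lam * expR (- lam * t) * G t)%:E =
   (hit_laplace P Y H k j lam * ((lam + ex j) / ex j))%:E)%E.
Proof.
move=> lam0.
have mexp D : measurable_fun D (fun w => expR (- lam * S0 w)).
  by apply: measurable_funTS; apply: measurableT_comp => //; exact: measurable_funM.
have e1 w : 0 <= expR (- lam * S0 w) <= 1.
  by rewrite expR_ge0/= -expR0 ler_expR mulNr oppr_le0 mulr_ge0// ltW.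
have iC : (P j).-integrable C (EFin \o (fun w => expR (- lam * S0 w))).
  apply: measurable_bounded_integrable => //.
    by rewrite (le_lt_trans (probability_le1 _ mC))// ltry.
  exists 1; split; first exact: num_real.
  move=> x x1 w _ /=; have /andP[h0 h1] := e1 w.
  by rewrite ger0_norm// (le_trans h1)// ltW.
pose c : R := \int[P j]_(w in C) expR (- lam * S0 w).
have cE : (\int[P j]_(w in C) (expR (- lam * S0 w))%:E = c%:E)%E.
  by rewrite /c /Rintegral fineK//; exact: integrable_fin_num iC.
have c0 : 0 <= c by apply: Rintegral_ge0 => w _; exact: expR_ge0.
have GcE : (\int[mu]_(t in `[0%R, +oo[) (lam * expR (- lam * t) * G t)%:E = c%:E)%E.
  rewrite -cE int_cdf//.
  by apply: eq_integral => t _; rewrite GE -EFinM.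
rewrite GcE; congr EFin.
have := @laplace_exponential _ _ _ (P j) C (fun w => expR (- lam * S0 w)) (H 0) c (ex j) lam
  lam0 (ltW ex_gt0) c0 mC (mexp setT) (mH 0) (fun w => expR_ge0 _) (H_gt0 0).
have hyp (s : R) : 0 <= s -> (\int[P j]_(w in C `&` [set w | (s < H 0 w)%R]) (expR (- lam * S0 w))%:E =
    (c * expR (- ex j * s))%:E)%E.
  move=> s0; rewrite int_cdf//; last by apply: measurableI => //; exact: mlt.
  rewrite [in RHS]mulrC EFinM -GcE -ge0_integralZl//.
  - apply: eq_integral => t _.
    rewrite setIAC -preimage_itvNyc indep0// preimage_itvNyc GE -!EFinM; congr EFin; ring.
  - exact: mw.
  - by move=> t _; rewrite lee_fin !mulr_ge0 ?expR_ge0// ltW.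
move=> /(_ hyp) key.
have : (hit_laplace P Y H k j lam)%:E = (c * (ex j / (lam + ex j)))%:E.
  rewrite -key -(hit_laplace_restrict lam0).
  by apply: eq_integral => w _; rewrite -expRD mulrDr.
by move=> [->]; field; rewrite !gt_eqF// addr_gt0.
Qed.

(** Since F' = q (G - F), the integral is q / lam times the difference of the transforms g (lam + q)
    / q and g computed in [laplace_G] and [laplace_F], which is g. *)
Lemma passage_laplaceE (lam : R) : 0 < lam ->
  passage_laplace P X j k lam = hit_laplace P Y H k j lam.
Proof.
move=> lam0; have jkF : (j == k) = false by apply/eqP.
rewrite /passage_laplace jkF /passage_density.
rewrite (_ : (fun t : R => fine _) = F); last by apply/funext => t; exact: passage_cdfE.
pose v (t : R) := expR (- lam * t) * (ex j * (G t - F t)).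
have v0 t : 0 <= v t by rewrite !mulr_ge0 ?expR_ge0 ?subr_ge0// ltW.
have mv D : measurable_fun D v.
  apply: measurable_funM; first exact: measurable_expRZ.
  by apply: measurable_funM => //; apply: measurable_funB.
transitivity (fine (\int[mu]_(t in `[0%R, +oo[) (v t)%:E)%E).
  (* The derivative is known for t > 0 only; the endpoint 0 is a null set. *)
  rewrite /Rintegral -integral_itv_obnd_cbnd; last by apply/measurable_EFinP; exact: mv.
  congr fine; apply: eq_integral => t; rewrite inE/= in_itv/= andbT => t0.
  congr EFin; rewrite /v mulNr; congr (_ * _).
  by rewrite derive1E; have [] := dF t0.
have := laplace_F lam0; have := laplace_G lam0.
set g := hit_laplace _ _ _ _ _ _ => lG lF.
have key : (\int[mu]_(t in `[0%R, +oo[) (v t)%:E + (ex j / lam)%:E * g%:E =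
   (ex j / lam)%:E * (g * ((lam + ex j) / ex j))%:E)%E.
  have ql0 : (0 <= (ex j / lam)%:E)%E by rewrite lee_fin divr_ge0// ltW.
  have wF t : (0 <= (lam * expR (- lam * t) * F t)%:E)%E by rewrite lee_fin !mulr_ge0 ?expR_ge0// ltW.
  have wG t : (0 <= (lam * expR (- lam * t) * G t)%:E)%E by rewrite lee_fin !mulr_ge0 ?expR_ge0// ltW.
  rewrite -lG -lF -!ge0_integralZl//; try (by apply: mw); try (by move=> t _).
  rewrite -ge0_integralD//.
  - apply: eq_integral => t _; rewrite -!EFinM -EFinD; congr EFin; rewrite /v; field.
    by rewrite gt_eqF.
  - by move=> t _; rewrite lee_fin.
  - by apply/measurable_EFinP; exact: mv.
  - by move=> t _; rewrite mule_ge0.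
  - by apply: emeasurable_funM => //; exact: mw.
rewrite (_ : (\int[mu]_(t in `[0%R, +oo[) (v t)%:E)%E = g%:E)//.
rewrite -[LHS](@addeK _ ((ex j / lam)%:E * g%:E)%E)// key -!EFinM -EFinB; congr EFin.
by field; rewrite !gt_eqF.
Qed.

End passage_density.

(** * Regularity of the Laplace transform of a hitting time *)

Section laplace_regularity.
Context (R : realType) (E : set nat) (q : nat -> nat -> R).
Context d (Omega : measurableType d) (P : nat -> probability Omega R).
Variables (Y : nat -> Omega -> nat) (H : nat -> Omega -> R).
Hypothesis lq : local_rates E q.
Hypothesis mY : forall n, measurable_fun setT (Y n).
Hypothesis mH : forall n, measurable_fun setT (H n).
Hypothesis YE : forall n w, E (Y n w).
Hypothesis H_gt0 : forall n w, 0 < H n w.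
Hypothesis law : has_jump_law E q P Y H.
Variable k : nat.

(** From j <= k the chain can climb to k by births, all of positive rate; induction on the distance
    n = k - j. *)
Lemma hit_laplace_gt0 (j n : nat) (lam : R) : E j -> E k -> 0 < lam ->
  (j + n)%N = k -> 0 < hit_laplace P Y H k j lam.
Proof.
move=> Ej Ek lam0; elim: n j Ej => [|n IH] j Ej jnk.
  by move: jnk Ej; rewrite addn0 => -> _; rewrite (hit_laplace_self lq mY mH YE H_gt0 law).
have jk : j <> k by lia.
rewrite (hit_laplace_first_step lq mY mH YE H_gt0 law Ej lam0 jk) /killed_step.
move/eqP/negbTE : (jk) => ->; rewrite big_ord_recr/=.
have exj := exit_rate_gt0 lq Ej.
rewrite ltr_pwDr//.
  rewrite mulr_gt0 ?divr_gt0 ?addr_gt0// ?(rate_up_gt0 lq)//.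
  by apply: IH; [exact: (state_up lq)|rewrite addSnnS].
apply: sumr_ge0 => m _; rewrite mulr_ge0 ?hit_laplace_ge0// divr_ge0 ?(rate_ge0 lq)//.
by rewrite addr_ge0// ltW.
Qed.

(** Differentiation under the integral on (lam/2, lam + 1): there T exp(-l T) <= 1/l <= 2/lam,
    because y <= exp(y). *)
Lemma derivable_hit_laplace (j : nat) (lam : R) : 0 < lam ->
  derivable (hit_laplace P Y H k j) lam 1.
Proof.
move=> lam0.
pose f (l : R) w := expR (- l * hit_time Y H k w).
have t0 w : 0 <= hit_time Y H k w by exact: hit_time_ge0.
have df l w : is_derive l (1 : R) (f ^~ w) (- hit_time Y H k w * f l w).
  rewrite (_ : f ^~ w = (fun l => expR (- hit_time Y H k w * l))).
    rewrite /f (_ : - l * _ = - hit_time Y H k w * l); last by ring.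
    exact: is_derive_expRZ.
  by apply/funext => x; rewrite /f; congr expR; ring.
have mhit := measurable_hit_event k mY.
apply: (@derivable_under_integral _ _ _ (P j) f (hit_event Y k) mhit lam (lam / 2) (lam + 1) _ _ _
  (fun=> 2 / lam)).
- by rewrite /= in_itv/= ltrDl ltr01 andbT ltr_pdivrMr// ltr_pMr// ltr1n.
- move=> l; rewrite /= in_itv/= => /andP[l0 _].
  have l_gt0 : 0 < l by apply: lt_trans l0; rewrite divr_gt0.
  apply: measurable_bounded_integrable => //.
  + by rewrite (le_lt_trans (probability_le1 _ mhit))// ltry.
  + exact: measurable_exp_hit_time.
  exists 1; split; first exact: num_real.
  move=> x x1 w _ /=; rewrite ger0_norm ?expR_ge0// (le_trans _ (ltW x1))//.
  by rewrite -expR0 ler_expR mulNr oppr_le0 mulr_ge0// ltW.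
- by move=> l w _ _; have [] := df l w.
- by move=> w; rewrite divr_ge0// ltW.
- exact: finite_measure_integrable_cst.
move=> l w; rewrite /= in_itv/= => /andP[l0 _] _.
have l_gt0 : 0 < l by apply: lt_trans l0; rewrite divr_gt0.
rewrite partial1of2E; have [_ ->] := df l w.
rewrite normrM normrN !ger0_norm ?expR_ge0// /f mulNr expRN.
rewrite ler_pdivrMr ?expR_gt0//.
apply: (@le_trans _ _ (2 / lam * (l * hit_time Y H k w))).
  rewrite mulrA -[leLHS]mul1r ler_wpM2r// mulrAC ler_pdivlMr// mul1r.
  by move: l0; rewrite ltr_pdivrMr// mulrC => /ltW.
rewrite ler_wpM2l ?divr_ge0 ?(ltW lam0)//.
by apply: le_trans (expR_ge1Dx _); rewrite lerDr.
Qed.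

End laplace_regularity.

(** * Mean and variance of the passage time *)

Lemma is_markov_chainP (R : realType) (d : measure_display)
    (Omega : measurableType d) (E : set nat) (q : nat -> nat -> R)
    (P : nat -> probability Omega R) (X : R -> Omega -> option nat) :
  is_markov_chain E q P X ->
  exists (Y : nat -> Omega -> nat) (H : nat -> Omega -> R),
    [/\ forall n, measurable_fun setT (Y n), forall n, measurable_fun setT (H n),
        forall n w, E (Y n w), forall n w, 0 < H n w &
        is_jump_path Y H X /\ has_jump_law E q P Y H].
Proof.
move=> [Y [H [YE H0 path law]]].
by exists (fun n => Y n : Omega -> nat), (fun n => H n : Omega -> R); split.
Qed.

Theorem mainTheorem4 (R : realType) (r : nat) (alpha beta : nat -> R) (xi : R)
  (alpha_gt0 : forall n, (r <= n)%N -> 0 < alpha n)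
  (beta_ge0 : forall n, (r.+1 <= n)%N -> 0 <= beta n)
  (xi_gt0 : 0 < xi)
  (d : measure_display) (Omega : measurableType d)
  (P : nat -> probability Omega R) (N : R -> Omega -> option nat)
  (N_chain : is_markov_chain [set n | (r <= n)%N]
               (bd_catastrophe_rate r alpha beta xi) P N)
  (d' : measure_display) (Omega' : measurableType d')
  (P' : nat -> probability Omega' R) (N' : R -> Omega' -> option nat)
  (N'_chain : is_markov_chain [set n | (r <= n)%N]
                (bd_rate r alpha beta) P' N')
  (N'_non_explosive : non_explosive r P' N')
  (j k : nat) (r_le_j : (r <= j)%N) (r_le_k : (r <= k)%N) (j_neq_k : j <> k) :
  let gamma := passage_laplace P' N' in
  ext_mean (P j) (passage_time N k) =
    ((1 - gamma j k xi) / (xi * gamma r k xi))%:E /\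
  ext_variance (P j) (passage_time N k) =
    (1 / (xi ^+ 2 * gamma r k xi ^+ 2) *
     (1 - gamma j k xi ^+ 2
      + 2 * xi * (1 - gamma j k xi) * derive1 (gamma r k) xi
      + 2 * xi * gamma r k xi * derive1 (gamma j k) xi))%:E.
Proof.
move=> gamma; have gamma_def : gamma = passage_laplace P' N' by [].
clearbody gamma.
have lq := local_bd_rate alpha_gt0 beta_ge0.
have lqc := local_bd_catastrophe_rate alpha_gt0 beta_ge0 xi_gt0.
have [Y [H [mY mH YE H0 [path law]]]] := is_markov_chainP N_chain.
have [Y' [H' [mY' mH' YE' H0' [path' law']]]] := is_markov_chainP N'_chain.
pose phi i := hit_laplace P Y H k i.
pose g i := hit_laplace P' Y' H' k i.
have gammaE i l : (r <= i)%N -> 0 < l -> gamma i k l = g i l.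
  rewrite gamma_def => ri l0; have [ik|/eqP ik] := eqVneq i k.
    rewrite ik /passage_laplace eqxx /g.
    by rewrite (hit_laplace_self lq mY' mH' YE' H0' law').
  exact: (passage_laplaceE lq mY' mH' YE' H0' path' law').
have phi_first lam i : 0 < lam -> (r <= i)%N -> i <> k ->
    phi i lam = killed_step (bd_catastrophe_rate r alpha beta xi) k lam (phi ^~ lam) i.
  by move=> lam0 ri ik; exact: (hit_laplace_first_step lqc mY mH YE H0 law).
have phik lam : 0 < lam -> phi k lam = 1.
  by move=> lam0; exact: (hit_laplace_self lqc mY mH YE H0 law).
have key lam i : 0 < lam -> (r <= i)%N ->
    (lam + xi) * phi i lam - xi * phi r lam = ((lam + xi) - xi * phi r lam) * g i (lam + xi).
  move=> lam0 ri; have mu0 : 0 < lam + xi by rewrite addr_gt0.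
  pose u i := (lam + xi) * phi i lam - xi * phi r lam.
  have uk : u k = lam + xi - xi * phi r lam by rewrite /u phik// mulr1.
  rewrite -uk -[LHS]/(u i).
  (* The constant [lam + xi + xi] bounds |u| because phi takes values in [0, 1]. *)
  apply: (@killed_step_unique _ _ _ lq k (lam + xi) (ltW mu0) u (lam + xi + xi)) => //.
  - move=> m rm; rewrite /u.
    have p01 n : 0 <= phi n lam <= 1.
      by rewrite (hit_laplace_ge0 P)/= (hit_laplace_le1 P mY mH H0)// ltW.
    have /andP[a0 a1] := p01 m; have /andP[b0 b1] := p01 r.
    rewrite ler_norml; apply/andP; split; nra.
  - exact: (catastrophe_shift alpha_gt0 beta_ge0 xi_gt0 lam0 (fun m rm mk => phi_first lam m lam0 rm mk)).
  - exact: (cvg_hit_laplace lq mY' mH' YE' H0' law').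
  - apply: (non_explosive_killed_step lq mY' mH' YE' H0' path' law') => // t t0.
    (* Non-explosion is stated as a sum from r on; states below r are never visited. *)
    rewrite (nneseries_split 0 r)// add0n N'_non_explosive// big_nat big1 ?add0e// => n /= nr.
    rewrite (_ : [set w | _] = set0) ?measure0//; apply/seteqP; split => // w /=.
    move=> /(jump_path_Some path' t0)[m _ Yn].
    by have := YE' m w; rewrite /= Yn leqNgt nr.
pose rho (lam : R) := (1 - g j (xi + lam)) / (lam + xi * g r (xi + lam)).
have gr_ge0 l : 0 <= g r l by exact: hit_laplace_ge0.
have gr_gt0 : 0 < g r xi.
  by apply: (hit_laplace_gt0 lq mY' mH' YE' H0' law' (n := (k - r)%N)) => //=; rewrite subnKC.
have phi_rho lam : 0 < lam -> 1 - phi j lam = lam * rho lam.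
  move=> lam0; have mu0 : 0 < lam + xi by rewrite addr_gt0.
  have D0 : 0 < lam + xi * g r (lam + xi) by rewrite ltr_pwDl// mulr_ge0// ltW.
  have Kr := key lam r lam0 (leqnn r); have Kj := key lam j lam0 r_le_j.
  rewrite /rho (addrC xi lam).
  move: Kr Kj D0; set a := g r _; set b := g j _; set x := phi r _; set y := phi j _ => Kr Kj D0.
  (* The identity [key] at i = r reads lam x = (lam + xi - xi x) a, solved here for x. *)
  have xE : x = (lam + xi) * a / (lam + xi * a).
    apply: (mulIf (lt0r_neq0 D0)); rewrite divfK ?gt_eqF//.
    by move: Kr; lra.
  apply: (mulfI (lt0r_neq0 mu0)); rewrite mulrBr mulr1.
  have -> : (lam + xi) * y = (lam + xi - xi * x) * b + xi * x by rewrite -Kj; ring.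
  by rewrite xE; field; rewrite gt_eqF.
pose gj' := derive1 (g j) xi; pose gr' := derive1 (g r) xi.
have dg i : is_derive (0 : R) (1 : R) (fun x : R => g i (xi + x)) (derive1 (g i) xi).
  have dgi : is_derive (xi + 0) (1 : R) (g i) (derive1 (g i) xi).
    apply: DeriveDef; first by rewrite addr0; exact: derivable_hit_laplace.
    by rewrite addr0 derive1E.
  have ds : is_derive (0 : R) (1 : R) (fun x : R => xi + x) 1.
    by apply: is_derive_eq; rewrite add0r mulr1.
  by have := @is_derive1_comp _ (g i) (fun x : R => xi + x) 0 _ _ dgi ds; rewrite mulr1.
(* The quotient rule at lam = 0, where the denominator of rho is xi g_r(xi) > 0. *)
pose rho' := (- gj' * (xi * g r xi) - (1 - g j xi) * (1 + xi * gr')) / (xi * g r xi) ^+ 2.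
have D0 : xi * g r xi != 0 by rewrite gt_eqF// mulr_gt0.
have drho : is_derive (0 : R) (1 : R) rho rho'.
  have dn : is_derive (0 : R) (1 : R) (fun x : R => 1 - g j (xi + x)) (- gj').
    by have := dg j => ?; apply: is_derive_eq; rewrite add0r mul1r.
  have dd : is_derive (0 : R) (1 : R) (fun x : R => x + xi * g r (xi + x)) (1 + xi * gr').
    by have := dg r => ?; apply: is_derive_eq.
  have d0 : 0 + xi * g r (xi + 0) != 0 by rewrite add0r addr0.
  have dv := @is_deriveV _ (fun x : R => x + xi * g r (xi + x)) 0 _ _ d0 dd.
  apply: (@is_derive_eq _ _ _ _ _ _ _ _ (is_deriveM dn dv)); rewrite /GRing.scale/= /rho' !(addr0, add0r).
  by field; rewrite !gt_eqF.
have rho0 : rho 0 = (1 - g j xi) / (xi * g r xi) by rewrite /rho !(addr0, add0r).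
have rho_ge0 : 0 <= rho 0.
  rewrite rho0 divr_ge0 ?subr_ge0//; last by rewrite mulr_ge0// ltW.
  by rewrite (hit_laplace_le1 P' mY' mH' H0')// ltW.
have mA := measurable_hit_event k mY.
have mS := measurable_hit_time mY mH k.
have S0 w : 0 <= hit_time Y H k w by exact: hit_time_ge0.
have phiE lam : 0 < lam ->
    (\int[P j]_(w in hit_event Y k) (expR (- lam * hit_time Y H k w))%:E = (phi j lam)%:E)%E.
  by move=> lam0; apply: (hit_laplaceE P mY mH H0); exact: ltW.
have timeE : passage_time N k =
    (fun w => if w \in hit_event Y k then (hit_time Y H k w)%:E else +oo%E).
  by apply/funext => w; exact: (passage_timeE H0 path).
have meanE := laplace_mean mA mS S0 phiE phi_rho drho.
have varE := laplace_variance mA mS S0 phiE phi_rho drho rho_ge0.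
(* [gamma] and [g] are known to agree on positive arguments only, which suffices near xi > 0. *)
have dgammaE i : (r <= i)%N -> derive1 (gamma i k) xi = derive1 (g i) xi.
  move=> ri; rewrite !derive1E; apply: near_eq_derive.
  by near=> x; rewrite gammaE//; near: x; exact: lt_nbhsr.
rewrite (dgammaE j r_le_j) (dgammaE r (leqnn r)) (gammaE j xi r_le_j xi_gt0) (gammaE r xi (leqnn r) xi_gt0).
have mean : ext_mean (P j) (passage_time N k) = (rho 0)%:E by rewrite /ext_mean timeE.
split; first by rewrite mean rho0.
rewrite /ext_variance mean timeE varE; congr EFin.
rewrite rho0 /rho' -/gj' -/gr'; field.
by rewrite !gt_eqF.
Unshelve. all: by end_near. Qed.
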